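(* Let $p$ be a prime number, let $d_1,d_2$ be two positive odd integers, and let $G$ be the pro-$p$ group with pro-$p$ presentation $$G=\langle\, x,y_1,\ldots,y_{d_1},z_1,\ldots,z_{d_2}\ \mid\ r_1=r_2=1\,\rangle,$$ where either (1.1.a) $d_1+d_2\geq 4$ and $$r_1=[x,y_1][y_2,y_3]\cdots[y_{d_1-1},y_{d_1}],\qquad r_2=[x,z_1][z_2,z_3]\cdots[z_{d_2-1},z_{d_2}];$$ or (1.1.b) $p$ is odd and $$r_1=y_1^p[y_1,x][y_2,y_3]\cdots[y_{d_1-1},y_{d_1}],\qquad r_2=z_1^p[z_1,x][z_2,z_3]\cdots[z_{d_2-1},z_{d_2}].$$ Then $G$ does not occur as (i.e., is not isomorphic to) the maximal pro-$p$ Galois group $G_{\mathbb{K}}(p)$ of any field $\mathbb{K}$ containing a root of 1 of order $p$ (and also $\sqrt{-1}$ if $p=2$). Hence, $G$ does not occur as the absolute Galois group of any field.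
   Context: Commutators are $[h,g]=h^{-1}g^{-1}hg$. If $d_1=1$ (resp. $d_2=1$), the product $[y_2,y_3]\cdots[y_{d_1-1},y_{d_1}]$ (resp. $[z_2,z_3]\cdots[z_{d_2-1},z_{d_2}]$) is empty. Presentations of pro-$p$ groups are meant in the topological sense. For a field $\mathbb{K}$ with separable closure $\bar{\mathbb{K}}_s$, the absolute Galois group is $\mathrm{Gal}(\bar{\mathbb{K}}_s/\mathbb{K})$. The maximal pro-$p$ Galois group $G_{\mathbb{K}}(p)$ is the maximal pro-$p$ quotient of the absolute Galois group; equivalently $G_{\mathbb{K}}(p)=\mathrm{Gal}(\mathbb{K}(p)/\mathbb{K})$, where $\mathbb{K}(p)$ is the compositum of all finite Galois $p$-extensions of $\mathbb{K}$. A ''root of 1 of order $p$'' is a primitive $p$-th root of unity. *)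

(* Defs.v *)
From HB Require Import structures.
From mathcomp Require Import all_boot all_order all_fingroup all_algebra all_field.
From mathcomp Require Import boolp classical_sets functions cardinality filter.
From mathcomp Require Import topology.

Set Implicit Arguments.
Unset Strict Implicit.
Unset Printing Implicit Defensive.

Import GRing.Theory.

Local Open Scope classical_set_scope.
Local Open Scope group_scope.

HB.mixin Record isTopologicalGroup G & Topological G & monoid.Group G := {
  mulg_continuous : continuous (fun z : G * G => z.1 * z.2);
  invg_continuous : continuous (fun x : G => x^-1)
}.

#[short(type="topGroupType")]
HB.structure Definition TopologicalGroup :=
  {G of Topological G & monoid.Group G & isTopologicalGroup G}.

Definition cont_hom (G H : topGroupType) (f : G -> H) : Prop :=
  continuous f /\ {morph f : x y / x * y}.

Definition top_isom (G H : topGroupType) : Prop :=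
  exists (f : G -> H) (g : H -> G),
    [/\ cont_hom f, cont_hom g, cancel f g & cancel g f].

Definition is_subgroup (G : groupType) (N : set G) : Prop :=
  [/\ N 1, forall x y, N x -> N y -> N (x * y) & forall x, N x -> N x^-1].

Definition is_normal (G : groupType) (N : set G) : Prop :=
  is_subgroup N /\ forall x g, N x -> N (x ^ g).

Definition lcosets_of (G : groupType) (N : set G) : set (set G) :=
  [set [set g * u | u in N] | g in [set: G]].

Definition profinite (G : topGroupType) : Prop :=
  [/\ compact [set: G], hausdorff_space G & totally_disconnected [set: G]].

Definition pro_p (p : nat) (G : topGroupType) : Prop :=
  profinite G /\
  forall N : set G, is_normal N -> open N ->
    exists n : nat, (lcosets_of N #= `I_(p ^ n)%N)%card.

(* As [X] is finite there is no condition of convergence to 1 on [h]. *)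
Definition free_pro_p (p : nat) (X : finType) (F : topGroupType)
    (iota : X -> F) : Prop :=
  pro_p p F /\
  forall H : topGroupType, pro_p p H -> forall h : X -> H,
    exists! f : F -> H, cont_hom f /\ forall a, f (iota a) = h a.

Definition closed_normal_closure (G : topGroupType) (R : set G) : set G :=
  [set g | forall N : set G, is_normal N -> closed N -> R `<=` N -> N g].

(* [G] is the quotient of the free pro-p group [F] on [iota] by the closed
   normal subgroup generated by the relators [R].  The topology of [G] is the
   quotient topology because [F] is compact and [G] is Hausdorff. *)
Definition pro_p_presentation (p : nat) (X : finType) (F : topGroupType)
    (iota : X -> F) (R : set F) (G : topGroupType) : Prop :=
  [/\ free_pro_p p iota, pro_p p G &
    exists pi : F -> G,
      [/\ cont_hom pi, forall g, exists w, pi w = g &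
          forall w, pi w = 1 <-> closed_normal_closure R w]].

(* The generators x, y_1, ..., y_d1, z_1, ..., z_d2; the values of the
   sequences [y] and [z] outside these ranges are irrelevant. *)
Definition generators (T : Type) (d1 d2 : nat) (x : T) (y z : nat -> T)
    (k : option ('I_d1 + 'I_d2)) : T :=
  match k with
  | None => x
  | Some (inl j) => y j.+1
  | Some (inr j) => z j.+1
  end.

(* [y_2,y_3][y_4,y_5]...[y_(d-1),y_d] for odd d; in the library,
   [~ g, h] = g^-1 * h^-1 * g * h. *)
Definition comm_tail (F : groupType) (d : nat) (y : nat -> F) : F :=
  \prod_(1 <= i < (d./2).+1) [~ y i.*2, y i.*2.+1].

Definition relator_a (F : groupType) (d : nat) (x : F) (y : nat -> F) : F :=
  [~ x, y 1%N] * comm_tail d y.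

Definition relator_b (p : nat) (F : groupType) (d : nat) (x : F)
    (y : nat -> F) : F :=
  y 1%N ^+ p * [~ y 1%N, x] * comm_tail d y.

Section GaloisGroup.
Variables (K L : fieldType) (i : {rmorphism K -> L}).

Definition is_aut_over (s : L -> L) : Prop :=
  [/\ zmod_morphism s, monoid_morphism s, bijective s
    & forall c, s (i c) = i c].

Record gal : Type :=
  Gal { gal_fun :> L -> L; _ : `[< is_aut_over gal_fun >] }.

HB.instance Definition _ := [isSub for gal_fun].
HB.instance Definition _ := [Choice of gal by <:].

Lemma galP (s : gal) : is_aut_over s.
Proof. by case: s => s /= /asboolP. Qed.

Lemma gal_ext (s t : gal) : s =1 t -> s = t.
Proof. by move=> st; apply/val_inj/funext. Qed.

Lemma gal_one_subproof : is_aut_over id.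
Proof. by split=> //; exists id. Qed.

Definition gal_one : gal := Gal (asboolT gal_one_subproof).

(* Product in the usual order: [s * t] is [s \o t]. *)
Lemma gal_mul_subproof (s t : gal) : is_aut_over (s \o t).
Proof.
have [sB [s1 sM] sb sK] := galP s; have [tB [t1 tM] tb tK] := galP t.
split=> [x y||| c] /=.
- by rewrite tB sB.
- by split=> [|x y] /=; rewrite ?t1 ?s1 // tM sM.
- exact: bij_comp.
- by rewrite tK sK.
Qed.

Definition gal_mul (s t : gal) : gal := Gal (asboolT (gal_mul_subproof s t)).

Lemma gal_surj (s : gal) (y : L) : exists x, s x = y.
Proof. by have [_ _ [g _ gK] _] := galP s; exists (g y). Qed.

Definition gal_inv_fun (s : gal) (y : L) : L := sval (cid (gal_surj s y)).

Lemma gal_inv_funK (s : gal) : cancel (gal_inv_fun s) s.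
Proof. by move=> y; rewrite /gal_inv_fun; case: cid. Qed.

Lemma gal_funK (s : gal) : cancel s (gal_inv_fun s).
Proof.
have [_ _ sb _] := galP s.
by move=> x; apply: (bij_inj sb); rewrite gal_inv_funK.
Qed.

Lemma gal_inv_subproof (s : gal) : is_aut_over (gal_inv_fun s).
Proof.
have [sB [s1 sM] sb sK] := galP s; have sI := bij_inj sb.
split=> [x y||| c].
- by apply: sI; rewrite sB !gal_inv_funK.
- by split=> [|x y]; apply: sI; rewrite ?sM !gal_inv_funK ?s1.
- by exists s; [exact: gal_inv_funK | exact: gal_funK].
- by apply: sI; rewrite gal_inv_funK sK.
Qed.

Definition gal_inv (s : gal) : gal := Gal (asboolT (gal_inv_subproof s)).

Lemma gal_mulA : associative gal_mul.
Proof. by move=> s t u; apply: gal_ext. Qed.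

Lemma gal_mul1 : left_id gal_one gal_mul.
Proof. by move=> s; apply: gal_ext. Qed.

Lemma gal_1mul : right_id gal_one gal_mul.
Proof. by move=> s; apply: gal_ext. Qed.

Lemma gal_mulV : left_inverse gal_one gal_inv gal_mul.
Proof. by move=> s; apply: gal_ext => x /=; rewrite gal_funK. Qed.

Lemma gal_Vmul : right_inverse gal_one gal_inv gal_mul.
Proof. by move=> s; apply: gal_ext => x /=; rewrite gal_inv_funK. Qed.

HB.instance Definition _ :=
  isGroup.Build gal gal_mulA gal_mul1 gal_1mul gal_mulV gal_Vmul.

(* The coset s Gal(L / K(e)), for a finite sequence e of elements of L.  If L
   is algebraic over K, the K(e) are the finite subextensions of L / K. *)
Definition krull_coset (s : gal) (e : seq L) : set gal :=
  [set t : gal | {in e, forall a, t a = s a}].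

Definition krull_open (U : set gal) : Prop :=
  forall s, U s -> exists e : seq L, krull_coset s e `<=` U.

Lemma krull_openT : krull_open setT.
Proof. by move=> s _; exists [::]. Qed.

Lemma krull_openI : setI_closed krull_open.
Proof.
move=> U V oU oV s [/oU[e eU] /oV[f fV]]; exists (e ++ f) => t st.
by split; [apply: eU | apply: fV] => a ae; apply: st; rewrite mem_cat ae ?orbT.
Qed.

Lemma krull_open_bigU (I : Type) (f : I -> set gal) :
  (forall j, krull_open (f j)) -> krull_open (\bigcup_j f j).
Proof.
move=> of_ s [j _ /of_[e eU]]; exists e => t /eU ft; by exists j.
Qed.

HB.instance Definition _ :=
  isOpenTopological.Build gal krull_openT krull_openI krull_open_bigU.

Lemma krull_coset_nbhs (s : gal) (e : seq L) : nbhs s (krull_coset s e).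
Proof.
rewrite nbhsE; exists (krull_coset s e) => //; split=> //.
suff: krull_open (krull_coset s e) by [].
by move=> t st; exists e => u tu a ae; rewrite tu // st.
Qed.

Lemma nbhs_krullP (s : gal) (A : set gal) :
  nbhs s A -> exists e : seq L, krull_coset s e `<=` A.
Proof.
rewrite nbhsE => -[U [oU Us] UA]; have [e eU] := oU s Us.
by exists e; apply: subset_trans UA.
Qed.

Lemma gal_mul_continuous : continuous (fun z : gal * gal => z.1 * z.2).
Proof.
move=> [s t] A /nbhs_krullP[e eA].
exists (krull_coset s (map t e), krull_coset t e).
  by split; exact: krull_coset_nbhs.
move=> [s' t'] /= [ss' tt']; apply: eA => a ae /=.
by change (s' (t' a) = s (t a)); rewrite (tt' a ae); apply: ss'; rewrite map_f.
Qed.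

Lemma gal_inv_continuous : continuous (fun s : gal => s^-1).
Proof.
move=> s A /nbhs_krullP[e eA].
apply: filterS (krull_coset_nbhs s (map (gal_inv_fun s) e)) => t st.
apply: eA => a ae; have [_ _ tb _] := galP t; apply: (bij_inj tb).
by rewrite gal_inv_funK st ?map_f // gal_inv_funK.
Qed.

HB.instance Definition _ :=
  isTopologicalGroup.Build gal gal_mul_continuous gal_inv_continuous.

End GaloisGroup.

Local Open Scope ring_scope.

Definition separable_over (K L : fieldType) (i : {rmorphism K -> L}) (a : L) :
    Prop :=
  exists q : {poly K},
    [/\ irreducible_poly q, separable_poly q & root (map_poly i q) a].

Definition is_separable_closure (K Ks : fieldType) (i : {rmorphism K -> Ks}) :
    Prop :=
  (forall a, separable_over i a) /\
  (forall q : {poly Ks}, separable_poly q -> (1 < size q)%N ->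
     exists a, root q a).

Section MaximalPExtension.
Variables (p : nat) (K Ks : fieldType) (i : {rmorphism K -> Ks}).

Definition galois_p_ext (E : splittingFieldType K) : Prop :=
  galois 1%VS {:E} /\ exists n, \dim {:E} = (p ^ n)%N.

Definition K_embedding (E : splittingFieldType K) (f : {rmorphism E -> Ks}) :
    Prop :=
  forall c : K, f c%:A = i c.

(* K(p): the compositum of all finite Galois p-extensions of K in Ks. *)
Definition in_Kp : {pred Ks} := fun x => `[<
  forall S : {pred Ks}, divring_closed S -> (forall c, i c \in S) ->
    (forall (E : splittingFieldType K) (f : {rmorphism E -> Ks}),
       galois_p_ext E -> K_embedding f -> forall u, f u \in S) ->
    x \in S >].

Lemma in_Kp_divring : divring_closed in_Kp.
Proof.
split=> [|x y /asboolP xS /asboolP yS|x y /asboolP xS /asboolP yS];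
  apply/asboolP => S dS iS fS; case: (dS) => S1 SB SM.
- exact: S1.
- by apply: SB; [exact: xS | exact: yS].
- by apply: SM; [exact: xS | exact: yS].
Qed.

HB.instance Definition _ := GRing.isDivringClosed.Build Ks in_Kp in_Kp_divring.

Record Kp : Type := MkKp { Kp_val : Ks; _ : in_Kp Kp_val }.

HB.instance Definition _ := [isSub for Kp_val].
HB.instance Definition _ := [Choice of Kp by <:].
HB.instance Definition _ := [SubChoice_isSubIntegralDomain of Kp by <:].
HB.instance Definition _ := [SubIntegralDomain_isSubField of Kp by <:].

Lemma in_Kp_base (c : K) : in_Kp (i c).
Proof. by apply/asboolP => S _ iS _; exact: iS. Qed.

Definition Kp_inj (c : K) : Kp := MkKp (in_Kp_base c).

Lemma Kp_inj_zmod : zmod_morphism Kp_inj.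
Proof. by move=> a b; apply: val_inj; rewrite /= rmorphB. Qed.

Lemma Kp_inj_monoid : monoid_morphism Kp_inj.
Proof.
by split=> [|a b]; apply: val_inj; rewrite /= ?rmorph1 ?rmorphM.
Qed.

HB.instance Definition _ := GRing.isZmodMorphism.Build K Kp Kp_inj Kp_inj_zmod.
HB.instance Definition _ :=
  GRing.isMonoidMorphism.Build K Kp Kp_inj Kp_inj_monoid.

End MaximalPExtension.

Definition abs_galois_group (K Ks : fieldType) (i : {rmorphism K -> Ks}) :
    topGroupType :=
  gal i.

Definition max_pro_p_galois_group (p : nat) (K Ks : fieldType)
    (i : {rmorphism K -> Ks}) : topGroupType :=
  gal (Kp_inj p i : {rmorphism K -> Kp p i}).

(* Main.v *)
From HB Require Import structures.
From Pilot Require Import Defs.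
From mathcomp Require Import all_boot all_order all_fingroup all_algebra all_field all_solvable.
From mathcomp Require Import boolp classical_sets functions cardinality filter.
From mathcomp Require Import topology ring zify.

(** Let Gam be the group of K-automorphisms of an algebraic extension L of K that
    contains a primitive p-th root of unity z fixed by Gam and is closed under
    p-th roots.  Gam acts on the group of p^2-th roots of unity of L through
    1 + p m, for a homomorphism m : Gam -> Z/p.  Given a homomorphism chi : H -> Z/p
    on an open subgroup H, Hilbert 90 provides a with s(a) = z^chi(s) a for s in H;
    if b^p = a, then s(b)/b is a p^2-th root of unity, and taking logarithms lifts
    chi to a crossed homomorphism H -> Z/p^2 for the action through 1 + p m.  This
    lifting property is [kummerian], and [gal_kummerian] establishes it.  It
    applies to L = K(p), which is closed under p-th roots by [Kp_pth_root].

    The groups presented in the theorem do not have this property, whatever m is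
    ([relators_a_not_kummerian], [relators_b_not_kummerian]).  Since the relators
    lie in the Frattini subgroup, the values of a homomorphism to Z/p can be
    prescribed on the generators.  A crossed homomorphism lifting it vanishes on
    the relators, and this determines m on the generators: m = 0 in case (a), and
    m(x) = 1, m(y_k) = m(z_k) = 0 in case (b) ([relator_a_bockstein],
    [relator_b_bockstein]).  It remains to find a subgroup H and a homomorphism
    chi on H without a lift.  Both come from a homomorphism rho from the presented
    group to the Heisenberg group of order p^5: H is the inverse image of an
    abelian normal subgroup containing the centre, and chi is the central
    coordinate of rho.

    In case (a) let d_1 >= 3, let x commute with z_1 under rho, and let y_2 and z_1
    have the same image in the quotient by H.  The first relator says that
    [x, y_1] is a commutator [y_3, y_2] up to commutators of elements of H, and
    the second one that x and x^(z_1) agree up to such commutators.  Summing the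
    first relation over the conjugates by 1, y_2, ..., y_2^(p-1) makes its right
    side telescope to 0, while the left side is p times the same term.  Hence
    p (e(x^(y_1)) - e(x)) = 0 for every homomorphism e defined where m vanishes in H
    ([hom_conj_torsion]); if e lifts chi, this is chi(x^(y_1)) = chi(x),
    whereas rho is chosen with chi(x) = 0 and chi(x^(y_1)) = 1.  In case (b) put
    w = y_1 z_1^-1.  The relators say that x raises y_1 and z_1 to the power
    1 - p up to commutators, which yields
    e(w^(x z_1)) - e(w^(z_1)) = e(w^x) - e(w) ([hom_conj_rigid]); as x acts on the
    coefficients as 1 + p, this is chi(w^(z_1)) = chi(w), again contrary to the
    choice of rho.

    Suppose now that the presented group is an absolute Galois group of K.  If the
    characteristic is not p, the stabilizer of a primitive p-th root of unity z is
    an open subgroup of index at most p - 1 and a power of p, so z is fixed and the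
    argument above applies to the separable closure.  If the characteristic is p,
    Artin-Schreier theory shows that the cup product of any two homomorphisms to
    Z/p vanishes ([gal_cup_products_vanish]); but the cup product of the ones dual
    to x and y_1 takes the value 1 or -1 on the first relator
    ([relators_cup_nontrivial]). *)

Set Implicit Arguments.
Unset Strict Implicit.
Unset Printing Implicit Defensive.
Import GRing.Theory.

Local Open Scope classical_set_scope.
Local Open Scope ring_scope.

(** * Group homomorphisms and algebraic extensions *)

Definition hom_on (G : groupType) (V : zmodType) (H : set G) (chi : G -> V) :=
  forall s t, H s -> H t -> chi (s * t)%g = chi s + chi t.

Lemma hom_morph1 (A B : groupType) (f : A -> B) : {morph f : s t / (s * t)%g} -> f 1%g = 1%g.
Proof. by move=> fM; apply: (mulIg (f 1%g)); rewrite -fM !mul1g. Qed.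
Lemma hom_morphV (A B : groupType) (f : A -> B) : {morph f : s t / (s * t)%g} ->
  {morph f : s / (s^-1)%g}.
Proof. by move=> fM s; apply: (mulgI (f s)); rewrite -fM !mulgV hom_morph1. Qed.

Lemma hom_morphJ (A B : groupType) (f : A -> B) : {morph f : s t / (s * t)%g} ->
  forall s t, f (s ^ t)%g = (f s ^ f t)%g.
Proof. by move=> fM s t; rewrite /conjg !fM (hom_morphV fM). Qed.

Definition algebraic_over (K L : fieldType) (i : {rmorphism K -> L}) : Prop :=
  forall a : L, exists2 q : {poly K}, q != 0 & root (map_poly i q) a.

(** * Splitting fields inside an algebraic extension *)

Section FiniteSubext.
Variables (K Ks : fieldType) (i : {rmorphism K -> Ks}).
Hypothesis alg : algebraic_over i.

(** The irreducible polynomial of r over M, without assuming decidability: a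
    nonzero polynomial of least size among those vanishing at r. *)
Lemma min_annihilator (M : fieldType) (f : {rmorphism M -> Ks}) (r : Ks) :
  (exists2 q : {poly M}, q != 0 & root (map_poly f q) r) ->
  exists q : {poly M}, [/\ q != 0, root (map_poly f q) r & irreducible_poly q].
Proof.
case=> q0 q0_n0 q0r.
pose P n := `[< exists q : {poly M}, [/\ q != 0, root (map_poly f q) r & size q = n] >].
have exP : exists n, P n by exists (size q0); apply/asboolP; exists q0.
case: (ex_minnP exP) => n /asboolP[q [q_n0 qr sq]] nmin.
exists q; split=> //; apply/(subfx_irreducibleP qr q_n0) => q' q'r q'_n0.
by rewrite sq; apply: nmin; apply/asboolP; exists q'.
Qed.

(** Roots are adjoined one at a time; every step is a simple extension of the
    previous field, seen again as an extension of K. *)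
Lemma finite_subext (e : seq Ks) :
  exists (M : fieldExtType K) (f : {rmorphism M -> Ks}),
    (forall c : K, f c%:A = i c) /\ exists e' : seq M, map f e' = e.
Proof.
elim: e => [|r e [M [f [fK [e' e'E]]]]].
  exists (K^o : fieldExtType K), (i : {rmorphism K^o -> Ks}).
  by split; [move=> c; congr (i _); exact: mulr1 | exists [::]].
have [|q [q_n0 qr q_irr]] := @min_annihilator M f r.
  have [q q_n0 qr] := alg r; exists (map_poly (in_alg M) q); first by rewrite map_poly_eq0.
  by rewrite -map_poly_comp (eq_map_poly fK).
pose E := SubFieldExtType qr q_irr.
pose g : {rmorphism baseFieldType E -> Ks} := @subfx_inj _ _ f r q.
have gM (b : M) : g (b%:A : E) = f b by apply: subfx_inj_base.
exists (baseFieldType E), g; split.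
  by move=> c; rewrite baseField_scaleE gM.
exists ((subfx_root f r q : E) :: [seq (b%:A : E) | b <- e']) => /=.
congr (_ :: _); first exact: subfx_inj_root.
by rewrite -map_comp -e'E; apply: eq_map => b; apply: gM.
Qed.

Lemma map_XsubC (A B : fieldType) (f : {rmorphism A -> B}) (s : seq A) :
  map_poly f (\prod_(a <- s) ('X - a%:P)) = \prod_(b <- map f s) ('X - b%:P).
Proof.
rewrite rmorph_prod big_map; apply: eq_bigr => a _ /=.
by rewrite rmorphB /= map_polyX map_polyC.
Qed.

(** The splitting field is cut out, as a subfield, of any finite extension
    containing the roots, so that it is generated by exactly these roots. *)
Lemma splitting_subext (Q : {poly K}) (e : seq Ks) :
  map_poly i Q %= \prod_(a <- e) ('X - a%:P) ->
  exists (E : splittingFieldType K) (f : {rmorphism E -> Ks}) (e' : seq E),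
    [/\ K_embedding i f, map f e' = e & <<1 & e'>>%VS = fullv].
Proof.
move=> Qe; have [M [f [fK [e0 fe0]]]] := finite_subext e.
pose E := subvs_of <<1 & e0>>%VS; pose j : 'AHom(E, M) := linfun_ahom vsval.
have [e1 je1] : exists e1, map j e1 = e0.
  exists [seq vsproj <<1 & e0>>%VS r | r <- e0].
  rewrite -map_comp -[RHS]map_id; apply/eq_in_map => r re0.
  by rewrite /= lfunE /= vsprojK ?seqv_sub_adjoin.
have je1' : map vsval e1 = e0 by apply: etrans je1; apply: eq_map => u; rewrite /= lfunE.
have fullE1 : <<1 & e1>>%VS = fullv.
  apply/vspaceP => u; have: val u \in (j @: <<1 & e1>>)%VS.
    by rewrite aimg_adjoin_seq aimg1 je1 (valP u).
  by case/memv_imgP => v ve1; rewrite memvf lfunE => /val_inj ->.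
pose g : {rmorphism E -> Ks} := f \o vsval.
have gK c : g c%:A = i c by rewrite -fK /=; congr (f _); rewrite -[LHS]/(c *: vsval (1 : E)) rmorph1.
have ge1 : map g e1 = e by rewrite map_comp je1'.
have axE : splitting_field_axiom E.
  exists (map_poly (in_alg E) Q); first by apply/polyOver1P; exists Q.
  exists e1 => //; rewrite -(eqp_map g) map_XsubC ge1 -map_poly_comp.
  by rewrite (eq_map_poly gK).
pose EP := FieldExt_isSplittingField.Build K E axE.
pose E' : splittingFieldType K := HB.pack E EP.
by exists E', (g : {rmorphism E' -> Ks}), e1.
Qed.
End FiniteSubext.

(** * Finite Galois p-extensions *)

Lemma gal_expg_iter (K : fieldType) (E : splittingFieldType K)
  (s : gal_of {:E}) n v : ((s ^+ n)%g : gal_of {:E}) v = iter n s v.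
Proof.
elim: n v => [|n IH] v; first by rewrite expg0 gal_id.
by rewrite expgS galM ?memvf // IH -iterSr.
Qed.

Lemma iter_fixM (T : Type) (f : T -> T) k m v :
  iter m f v = v -> iter (k * m) f v = v.
Proof. by move=> fv; elim: k => // k IH; rewrite mulSn iterD IH. Qed.

(* p-extension criterion *)
(** By Cauchy's theorem a finite group in which every element has p-power order is
    a p-group.  The order of an automorphism can be tested on generators, which is
    how composita and radical extensions are handled below. *)
Lemma galois_p_ext_criterion (p : nat) (K : fieldType) (E : splittingFieldType K)
  (e : seq E) :
  prime p -> galois 1 {:E} -> <<1 & e>>%VS = fullv ->
  (forall s, s \in 'Gal({:E} / 1)%g -> forall v, v \in e ->
     exists n, iter (p ^ n) s v = v) ->
  galois_p_ext p E.
Proof.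
move=> p_pr galE fullE pE; split=> //.
suff /p_natP[n En] : p.-nat #|'Gal({:E} / 1)%g|.
  by exists n; rewrite -En -(galois_dim galE) dimv1 divn1.
apply/pgroupP => q q_pr /(Cauchy q_pr)[s sG sq].
have [n ns] : exists n, {in e, forall v, iter (p ^ n) s v = v}.
  elim: (e) (pE s sG) => [|v e' IH] e's; first by exists 0%N.
  have [n1 n1v] := e's v (mem_head _ _).
  have [u ue'|n2 n2v] := IH; first by apply: e's; rewrite inE ue' orbT.
  exists (n1 + n2)%N => u; rewrite expnD inE => /predU1P[->|ue'].
    by rewrite mulnC iter_fixM.
  by rewrite iter_fixM // n2v.
have s1 : (s ^+ (p ^ n) = 1)%g.
  apply/eqP/gal_eqP => a _; rewrite gal_id.
  have: a \in <<1 & e>>%VS by rewrite fullE memvf.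
  have /subvP h : (<<1 & e>> <= fixedField [set (s ^+ (p ^ n))%g])%VS.
    apply/Fadjoin_seqP; split; first exact: sub1v.
    move=> v ve; apply/fixedFieldP; rewrite ?memvf // => t /set1P->.
    by rewrite gal_expg_iter ns.
  by move=> /h/mem_fixedFieldP[_]; apply; rewrite inE.
have: (q %| p ^ n)%N by rewrite -sq order_dvdn s1.
by rewrite Euclid_dvdX // => /andP[qp _]; rewrite inE -(dvdn_prime2 q_pr p_pr).
Qed.

Section Restrict.
Variables (K Ks : fieldType) (i : {rmorphism K -> Ks}) (p : nat).

Lemma factor_embedding (E0 E : splittingFieldType K)
  (f0 : {rmorphism E0 -> Ks}) (f : {rmorphism E -> Ks}) :
  K_embedding i f0 -> K_embedding i f ->
  (forall u, exists v, f v = f0 u) ->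
  exists g : 'AHom(E0, E), forall u, f (g u) = f0 u.
Proof.
move=> f0K fK /choice[g gE].
have gB : zmod_morphism g.
  by move=> u v; apply: (fmorph_inj f); rewrite !(gE, rmorphB).
have gM : monoid_morphism g.
  by split=> [|u v]; apply: (fmorph_inj f); rewrite !(gE, rmorphM, rmorph1).
have gZ : scalable g.
  move=> c u; apply: (fmorph_inj f); rewrite gE -[c *: u]mulr_algl.
  by rewrite -[c *: g u]mulr_algl !rmorphM /= gE f0K fK.
pose Ag := GRing.isZmodMorphism.Build _ _ g gB.
pose Mg := GRing.isMonoidMorphism.Build _ _ g gM.
pose Zg := GRing.isScalable.Build _ _ _ _ g gZ.
pose g' : {lrmorphism E0 -> E} := HB.pack g Ag Mg Zg.
exists (linfun_ahom g') => u; rewrite -gE; congr (f _).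
exact: (lfunE g').
Qed.

(** The image of E0 is a normal subfield M of E, so automorphisms of E restrict to
    M, and they do so through the group Gal(M / K) of order p^n. *)
Lemma iter_gal_p_ext (E0 E : splittingFieldType K) (g : 'AHom(E0, E)) :
  galois_p_ext p E0 -> galois 1 {:E} ->
  exists n, forall s, s \in 'Gal({:E} / 1)%g -> forall u,
    iter (p ^ n) s (g u) = g u.
Proof.
case=> galE0 [n dimE0] galE; exists n => s sG u.
pose M : {subfield E} := (g @: {:E0})%AS.
have s1M : (1 <= M <= {:E})%VS by rewrite sub1v subvf.
have nM : normalField 1 M.
  have [q /polyOver1P[q0 ->] [r qr full]] := @splittingFieldP _ E0.
  apply/splitting_normalField; first exact: sub1v.
  exists (map_poly (in_alg E) q0); first by apply/polyOver1P; exists q0.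
  exists (map g r); last first.
    transitivity (g @: <<1 & r>>)%VS; last by rewrite full.
    by rewrite aimg_adjoin_seq aimg1.
  rewrite -map_XsubC (_ : map_poly _ _ = map_poly g (map_poly (in_alg E0) q0)).
    by rewrite eqp_map.
  rewrite -map_poly_comp; apply: eq_map_poly => c /=.
  by rewrite linearZ rmorph1.
have galM := normalField_galois galE s1M nM.
have dimM : #|'Gal(M / 1)%g| = (p ^ n)%N.
  rewrite -galois_dim // dimv1 divn1 -dimE0 limg_dim_eq //.
  apply/eqP; rewrite -subv0; apply/subvP => v; rewrite memv_cap => /andP[_].
  by rewrite memv_ker fmorph_eq0 => /eqP ->; rewrite mem0v.
have sM := normalField_cast_eq s1M nM.
have gu : g u \in M by rewrite memv_img ?memvf.
rewrite -gal_expg_iter -sM ?groupX //.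
have -> : normalField_cast M (s ^+ (p ^ n))%g = 1%g.
  rewrite (morphX (normalField_cast_morphism s1M nM)) //.
  rewrite -dimM; apply/eqP; rewrite -order_dvdn order_dvdG //.
  have := mem_morphim (normalField_cast_morphism s1M nM) sG sG.
  by rewrite (normalField_img galE s1M nM).
by rewrite gal_id.
Qed.
End Restrict.

(** * Roots in a separable closure *)

Lemma eq_expr_prim_root (L : fieldType) (p : nat) (z x y : L) :
  p.-primitive_root z -> x ^+ p = y ^+ p -> exists k, x = z ^+ k * y.
Proof.
move=> zP xy; have p_gt0 := prim_order_gt0 zP.
have [y0|y_n0] := eqVneq y 0.
  exists 0%N; apply/eqP; rewrite y0 mulr0.
  by move: (expf_eq0 x p); rewrite xy y0 expr0n gtn_eqF //= eqxx p_gt0.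
have [k xyk] : {k : 'I_p | x / y = z ^+ k}.
  by apply: (prim_rootP zP); rewrite expr_div_n xy divff ?expf_neq0.
by exists k; rewrite -xyk divfK.
Qed.

Section SepClosed.
Variables (K Ks : fieldType) (i : {rmorphism K -> Ks}).
Hypothesis sepK : is_separable_closure i.

Lemma sep_closure_alg : algebraic_over i.
Proof. by move=> a; have [/(_ a)[q [/irredp_neq0 q0 _ qa]] _] := sepK; exists q. Qed.

(** Separability is inherited from the separable closure. *)
Lemma sep_closure_galois (E : splittingFieldType K) (f : {rmorphism E -> Ks}) :
  K_embedding i f -> galois 1 {:E}.
Proof.
move=> fK; rewrite /galois subvf normalFieldf andbT /=.
apply/separableP => v _; apply/separable_elementP.
have [/(_ (f v))[q [_ qsep qv]] _] := sepK.
exists (map_poly (in_alg E) q); split; first by apply/polyOver1P; exists q.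
  rewrite -(fmorph_root f) -map_poly_comp.
  by rewrite (eq_map_poly fK).
by rewrite separable_map.
Qed.

Lemma sep_closure_pth_root (p : nat) (c : Ks) :
  (0 < p)%N -> p%:R != 0 :> Ks -> exists b, b ^+ p = c.
Proof.
move=> p_gt0 p_n0; have [->|c_n0] := eqVneq c 0.
  by exists 0; rewrite expr0n gtn_eqF.
have [_ /(_ ('X^p - c%:P))[||b]] := sepK.
- rewrite separable_poly.unlock !derivE subr0.
  apply/Bezout_coprimepP; exists (1, - (p%:R^-1)%:P * 'X) => /=.
  have -> : 'X^(p.-1) *+ p = p%:R%:P * 'X^(p.-1) :> {poly Ks}.
    by rewrite polyC_natr mulr_natl.
  rewrite mulrACA mulNr -polyCM mulVf // mulN1r -exprS prednK // mul1r.
  by rewrite addrC addKr -polyCN polyC_eqp1 oppr_eq0.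
- by rewrite size_XnsubC.
by rewrite /root !hornerE subr_eq0 => /eqP <-; exists b.
Qed.

Lemma sep_closure_split_pth (p : nat) (z : Ks) (c : Ks) : prime p ->
  p.-primitive_root z ->
  exists s : seq Ks, 'X^p - c%:P = \prod_(b <- s) ('X - b%:P).
Proof.
move=> p_pr zP; have p_gt0 := prime_gt0 p_pr.
have [b bp] := sep_closure_pth_root c p_gt0 (prim_root_natf_neq0 zP).
have [b0|b_n0] := eqVneq b 0.
  exists (nseq p 0); rewrite big_nseq subr0 -bp b0 expr0n gtn_eqF //= subr0.
  by elim: (p) => //= n <-; rewrite exprS.
exists [seq z ^+ k * b | k <- iota 0 p].
rewrite (@all_roots_prod_XsubC _ ('X^p - c%:P) [seq z ^+ k * b | k <- iota 0 p]).
- by rewrite lead_coefDl ?lead_coefXn ?scale1r // size_polyXn size_polyN size_polyC; case: (c == 0).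
- by rewrite size_XnsubC // size_map size_iota.
- apply/allP => _ /mapP[k _ ->].
  by rewrite /root !hornerE exprMn bp exprAC (prim_expr_order zP) expr1n mul1r subrr.
rewrite uniq_rootsE map_inj_in_uniq ?iota_uniq // => k l.
rewrite !mem_iota !add0n /= => kp lp /(mulIf b_n0)/eqP.
by rewrite (eq_prim_root_expr zP) !modn_small // => /eqP.
Qed.

End SepClosed.

(** * The field K(p) is closed under p-th roots *)

Lemma sub_image_adjoin (K Ks : fieldType) (i : {rmorphism K -> Ks})
  (E0 E : splittingFieldType K) (f0 : {rmorphism E0 -> Ks}) (f : {rmorphism E -> Ks})
  (e0 : seq E0) :
  K_embedding i f0 -> K_embedding i f ->
  (forall u, u \in e0 -> exists v, f v = f0 u) ->
  forall u, u \in <<1 & e0>>%VS -> exists v, f v = f0 u.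
Proof.
move=> f0K fK; elim/last_ind: e0 => [_ u|e u0 IH e_f u].
  rewrite Fadjoin_nil => /vlineP[c ->]; exists c%:A.
  by rewrite f0K fK.
rewrite adjoin_rcons => /Fadjoin_polyP[q /polyOverP qe ->].
have [|v0 v0E] := e_f u0; first by rewrite mem_rcons mem_head.
have {}IH u' : u' \in <<1 & e>>%VS -> exists v, f v = f0 u'.
  by apply: IH => u1 ue; apply: e_f; rewrite mem_rcons inE ue orbT.
have [c cE] := choice (fun k => IH _ (qe k)).
exists (\sum_(k < size q) c k * v0 ^+ k).
rewrite horner_coef !rmorph_sum; apply: eq_bigr => k _ /=.
by rewrite !rmorphM !rmorphXn cE v0E.
Qed.

Lemma map_in_alg (K Ks : fieldType) (i : {rmorphism K -> Ks})
  (E : splittingFieldType K) (f : {rmorphism E -> Ks}) (q : {poly K}) :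
  K_embedding i f -> map_poly f (map_poly (in_alg E) q) = map_poly i q.
Proof. by move=> fK; rewrite -map_poly_comp; apply: eq_map_poly. Qed.

Section JoinRoot.
Variables (K Ks : fieldType) (i : {rmorphism K -> Ks}) (p : nat) (zeta : K).
Hypothesis sepK : is_separable_closure i.
Hypothesis p_pr : prime p.
Hypothesis zetaP : p.-primitive_root zeta.

Let iP : p.-primitive_root (i zeta). Proof. by rewrite fmorph_primitive_root. Qed.

Lemma splitting_comp_Xp (s : seq Ks) :
  exists t : seq Ks, \prod_(b <- s) ('X^p - b%:P) = \prod_(b <- t) ('X - b%:P)
   /\ forall a, a \in t -> a ^+ p \in s.
Proof.
elim: s => [|b s [t [tE ts]]]; first by exists [::]; rewrite !big_nil.
have [t0 t0E] := sep_closure_split_pth sepK b p_pr iP.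
exists (t0 ++ t); rewrite big_cons big_cat t0E tE; split=> // a.
rewrite mem_cat inE => /orP[at0|/ts ->]; last exact: orbT.
have : root ('X^p - b%:P) a by rewrite t0E root_prod_XsubC.
by rewrite /root !hornerE subr_eq0 => ->.
Qed.

(** The field E is generated by E1, E2 and all p-th roots of all conjugates of a:
    it is the splitting field of Q1 Q2 q(X^p), with q the minimal polynomial of a.
    An automorphism of E raised to the power p^n fixes E1 and E2 for n large; then
    it multiplies each of those p-th roots by a p-th root of unity of K, so its
    p-th power is the identity.  The same statement thus gives both composita and
    closure under p-th roots. *)
Lemma p_ext_join_root (E1 E2 : splittingFieldType K)
  (f1 : {rmorphism E1 -> Ks}) (f2 : {rmorphism E2 -> Ks}) (a : E2) (alpha : Ks) :
  galois_p_ext p E1 -> galois_p_ext p E2 ->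
  K_embedding i f1 -> K_embedding i f2 -> alpha ^+ p = f2 a ->
  exists (E : splittingFieldType K) (f : {rmorphism E -> Ks}),
    [/\ galois_p_ext p E, K_embedding i f, (forall u, exists v, f v = f1 u),
        (forall u, exists v, f v = f2 u) & exists v, f v = alpha].
Proof.
move=> E1p E2p f1K f2K alphaP.
have [_ /polyOver1P[Q1 ->] [r1 Q1r r1full]] := @splittingFieldP _ E1.
have [_ /polyOver1P[Q2 ->] [r2 Q2r r2full]] := @splittingFieldP _ E2.
have [b /eqP aE] := splitting_field_normal 1%AS a.
have /polyOver1P[q qE] := minPolyOver 1 a.
have [t [tE tb]] := splitting_comp_Xp (map f2 b).
have qt : map_poly i (q \Po 'X^p) = \prod_(c <- t) ('X - c%:P).
  rewrite map_comp_poly map_polyXn -(map_in_alg _ f2K) -qE aE map_XsubC -tE.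
  rewrite rmorph_prod; apply: eq_bigr => c _ /=.
  by rewrite rmorphB /= comp_polyX comp_polyC.
pose e := map f1 r1 ++ map f2 r2 ++ t.
have eE : map_poly i (Q1 * Q2 * (q \Po 'X^p)) %= \prod_(c <- e) ('X - c%:P).
  rewrite !rmorphM /= qt !big_cat /= mulrA eqp_mul2r ?monic_neq0 ?monic_prod_XsubC //.
  have Q1i : map_poly i Q1 %= \prod_(c <- map f1 r1) ('X - c%:P).
    by rewrite -(map_in_alg _ f1K) -map_XsubC eqp_map.
  have Q2i : map_poly i Q2 %= \prod_(c <- map f2 r2) ('X - c%:P).
    by rewrite -(map_in_alg _ f2K) -map_XsubC eqp_map.
  exact: eqp_trans (eqp_mulr _ Q1i) (eqp_mull _ Q2i).
have [E [f [e' [fK fe' full]]]] := splitting_subext (sep_closure_alg sepK) eE.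
have galE := sep_closure_galois sepK fK.
have ef c : c \in e -> exists v, f v = c.
  by rewrite -fe' => /mapP[v _ ->]; exists v.
have f1f u : exists v, f v = f1 u.
  apply: (sub_image_adjoin f1K fK (e0 := r1)) => [u' u'r|]; last by rewrite r1full memvf.
  by apply: ef; rewrite mem_cat map_f.
have f2f u : exists v, f v = f2 u.
  apply: (sub_image_adjoin f2K fK (e0 := r2)) => [u' u'r|]; last by rewrite r2full memvf.
  by apply: ef; rewrite !mem_cat map_f ?orbT.
exists E, f; split=> //; last first.
  apply: ef; rewrite !mem_cat -(root_prod_XsubC t) -qt map_comp_poly map_polyXn.
  rewrite (_ : root (_ \Po _) alpha = true) ?orbT //; apply/eqP.
  rewrite horner_comp hornerXn alphaP -(map_in_alg _ f2K) horner_map /= -qE.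
  by rewrite (eqP (root_minPoly 1 a)) rmorph0.
apply: (galois_p_ext_criterion p_pr galE full) => s sG v ve'.
have [g1 g1E] := factor_embedding f1K fK f1f.
have [g2 g2E] := factor_embedding f2K fK f2f.
have [n1 n1P] := iter_gal_p_ext g1 E1p galE.
have [n2 n2P] := iter_gal_p_ext g2 E2p galE.
have : f v \in e by rewrite -fe' map_f.
rewrite !mem_cat => /or3P[/mapP[u _]|/mapP[u _]|/tb/mapP[u _]].
- by rewrite -g1E => /fmorph_inj ->; exists n1; apply: n1P.
- by rewrite -g2E => /fmorph_inj ->; exists n2; apply: n2P.
rewrite -rmorphXn -g2E => /fmorph_inj vp; exists n2.+1.
(* tau fixes E2, hence v^p, so that it multiplies v by a p-th root of unity. *)
set tau := (s ^+ (p ^ n2))%g.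
have zE : p.-primitive_root (zeta%:A : E) by rewrite (fmorph_primitive_root (in_alg E)).
have tz k : tau ((zeta%:A : E) ^+ k) = zeta%:A ^+ k.
  by rewrite rmorphXn /= linearZ rmorph1.
have tv : tau (v ^+ p) = v ^+ p by rewrite vp /tau gal_expg_iter n2P.
have [k kE] : exists k, tau v = zeta%:A ^+ k * v.
  by apply: (eq_expr_prim_root zE); rewrite -tv rmorphXn.
have it m : iter m tau v = zeta%:A ^+ (k * m) * v.
  elim: m => [|m IH]; first by rewrite muln0 mul1r.
  by rewrite iterS IH rmorphM /= tz kE mulrA -exprD mulnS addnC.
rewrite -gal_expg_iter expnS mulnC expgM gal_expg_iter it.
by rewrite mulnC exprM (prim_expr_order zE) expr1n mul1r.
Qed.

Definition in_p_ext (x : Ks) : Prop :=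
  exists (E : splittingFieldType K) (f : {rmorphism E -> Ks}),
    [/\ galois_p_ext p E, K_embedding i f & exists u, f u = x].

(** The compositum of all finite Galois p-extensions is their union, because they
    form a directed family. *)
Lemma in_KpP (x : Ks) : in_Kp p i x <-> in_p_ext x.
Proof.
split=> [/asboolP/(_ [pred y | `[< in_p_ext y >]])|]; last first.
  move=> [E [f [Ep fK [u <-]]]]; apply/asboolP => S _ _; exact.
have p_gt0 := prime_gt0 p_pr.
have pK (E : splittingFieldType K) (f : {rmorphism E -> Ks}) : galois_p_ext p E -> K_embedding i f ->
    forall u, in_p_ext (f u).
  by move=> Ep fK u; exists E, f; split=> //; exists u.
have join x1 x2 : in_p_ext x1 -> in_p_ext x2 ->
    exists (E : splittingFieldType K) (f : {rmorphism E -> Ks}) (u1 u2 : E),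
    [/\ galois_p_ext p E, K_embedding i f, f u1 = x1 & f u2 = x2].
  move=> [E1 [f1 [E1p f1K [u1 <-]]]] [E2 [f2 [E2p f2K [u2 <-]]]].
  have [|E [f [Ep fK /(_ u1)[v1 v1E] /(_ u2)[v2 v2E] _]]] :=
      @p_ext_join_root E1 E2 f1 f2 0 0 E1p E2p f1K f2K.
    (* A compositum is obtained by adjoining the p-th root 0 of 0. *)
    by rewrite rmorph0 expr0n gtn_eqF.
  by exists E, f, v1, v2.
have baseK c : in_p_ext (i c).
  have Ep : galois_p_ext p (K^o : splittingFieldType K).
    split; last by exists 0%N; rewrite dimvf /dim /=.
    apply/splitting_galoisField; exists 1; split; first exact: rpred1.
      by rewrite separable_poly.unlock coprime1p.
    exists [::]; first by rewrite big_nil eqpxx.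
    by rewrite Fadjoin_nil; apply/esym/regular_fullv.
  apply: (pK (K^o : splittingFieldType K) (i : {rmorphism K^o -> Ks})) => //.
  by move=> d; congr (i _); exact: mulr1.
move=> h; apply/asboolP; apply: h.
- split=> [|x1 x2|x1 x2]; first by apply/asboolP; rewrite -(rmorph1 i).
    move=> /asboolP x1p /asboolP x2p; apply/asboolP.
    by have [E [f [u1 [u2 [Ep fK <- <-]]]]] := join _ _ x1p x2p; rewrite -rmorphB; apply: pK.
  move=> /asboolP x1p /asboolP x2p; apply/asboolP.
  by have [E [f [u1 [u2 [Ep fK <- <-]]]]] := join _ _ x1p x2p; rewrite -fmorphV -rmorphM; apply: pK.
- by move=> c; apply/asboolP.
by move=> E f Ep fK u; apply/asboolP; apply: pK.
Qed.

Lemma Kp_pth_root (x : Kp p i) : exists y, y ^+ p = x.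
Proof.
case: x => x xp; have := xp; rewrite in_KpP => -[E [f [Ep fK [u uE]]]].
have [a aE] := sep_closure_pth_root sepK x (prime_gt0 p_pr) (prim_root_natf_neq0 iP).
have [|E' [f' [Ep' fK' _ _ vE]]] := @p_ext_join_root E E f f u a Ep Ep fK fK.
  by rewrite uE.
have ap : in_Kp p i a by apply/in_KpP; exists E', f'.
exists (MkKp ap); apply: val_inj.
by rewrite -[LHS]/(val (MkKp ap ^+ p)) rmorphXn /= aE.
Qed.
End JoinRoot.

(** * Averages over finite orbits *)

Section GalMorphism.
Variables (K L : fieldType) (i : {rmorphism K -> L}).

Lemma gal_zmod_morphism (s : Defs.gal i) : zmod_morphism s.
Proof. by have [] := galP s. Qed.
Lemma gal_monoid_morphism (s : Defs.gal i) : monoid_morphism s.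
Proof. by have [] := galP s. Qed.
HB.instance Definition _ (s : Defs.gal i) :=
  GRing.isZmodMorphism.Build L L s (gal_zmod_morphism s).
HB.instance Definition _ (s : Defs.gal i) :=
  GRing.isMonoidMorphism.Build L L s (gal_monoid_morphism s).

Lemma gal_mulE (s t : Defs.gal i) a : (s * t)%g a = s (t a).
Proof. by []. Qed.
Lemma gal_base (s : Defs.gal i) c : s (i c) = i c.
Proof. by have [] := galP s. Qed.
Lemma gal_oneE a : (1%g : Defs.gal i) a = a.
Proof. by []. Qed.
Lemma gal_invK (s : Defs.gal i) a : (s^-1)%g (s a) = a.
Proof. by rewrite -gal_mulE mulVg. Qed.

(* Here s is applied as a plain function, which lets equations about s a be used
   for rewriting; the general morphism lemmas produce another form. *)
Lemma gal_funM (s : Defs.gal i) a b : s (a * b) = s a * s b.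
Proof. exact: rmorphM. Qed.
Lemma gal_funX (s : Defs.gal i) n a : s (a ^+ n) = s a ^+ n.
Proof. exact: rmorphXn. Qed.
End GalMorphism.

(** Dedekind's independence of characters, for maps that are multiplicative on a
    set B only.  Here B will be the field fixed by an open subgroup, on which
    distinct cosets act differently. *)
Lemma dedekind_independence (L : fieldType) (I : eqType) (B : L -> Prop)
  (S : seq I) (g : I -> L -> L) (k : I -> L) :
  B 1 -> (forall a b, B a -> B b -> B (a * b)) ->
  (forall u, g u 1 = 1) -> (forall u a b, B a -> B b -> g u (a * b) = g u a * g u b) ->
  uniq S ->
  {in S &, forall u v, u != v -> exists2 b, B b & g u b != g v b} ->
  (forall b, B b -> \sum_(u <- S) k u * g u b = 0) ->
  {in S, forall u, k u = 0}.
Proof.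
move=> B1 BM g1 gM; elim: S k => // v S IH k /= /andP[vS uS] sep sum0.
have kS : {in S, forall u, k u = 0}.
  move=> w wS; have wv : w != v by apply: contraNneq vS => <-.
  have [||b0 Bb0 wvb] := sep w v _ _ wv; [by rewrite inE wS orbT | exact: mem_head |].
  apply: (mulIf (_ : g w b0 - g v b0 != 0)); first by rewrite subr_eq0.
  rewrite mul0r; apply: (IH (fun u => k u * (g u b0 - g v b0))) wS => //.
    by move=> u u' uS' u'S uu'; apply: (sep u u') uu'; rewrite inE ?uS' ?u'S orbT.
  move=> b Bb; have := sum0 _ (BM _ _ Bb0 Bb).
  rewrite big_cons gM // => /(canRL (addKr _)); rewrite addr0 => sum1.
  have := sum0 b Bb; rewrite big_cons => /(canRL (addKr _)); rewrite addr0 => sum2.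
  transitivity (\sum_(u <- S) k u * g u (b0 * b) - g v b0 * \sum_(u <- S) k u * g u b).
    rewrite mulr_sumr -sumrB; apply: eq_bigr => u _.
    by rewrite gM //; ring.
  by rewrite sum1 sum2 mulrN opprK mulrCA addNr.
move=> u; rewrite inE => /predU1P[->|/kS //].
have := sum0 1 B1; rewrite big_cons g1 mulr1 big1_seq ?addr0 // => w /andP[_ /kS ->].
by rewrite mul0r.
Qed.

Lemma roots_seq (L : fieldType) (q : {poly L}) :
  q != 0 -> exists s : seq L, forall a, root q a -> a \in s.
Proof.
have [n] := ubnP (size q); elim: n q => // n IH q sq q0.
have [[a qa]|noroot] := boolp.pselect (exists a, root q a); last first.
  by exists [::] => a qa; case: noroot; exists a.
have [q' qE] := factor_theorem _ _ qa.
have q'0 : q' != 0 by apply: contraNneq q0 => q'0; rewrite qE q'0 mul0r.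
have [|s sP] := IH q' _ q'0.
  by move: sq; rewrite qE size_Mmonic ?monicXsubC // size_XsubC addn2.
exists (a :: s) => b; rewrite qE rootM root_XsubC orbC inE.
by case/orP => [->|/sP ->] //; rewrite orbT.
Qed.

Section Orbits.
Variables (K L : fieldType) (i : {rmorphism K -> L}).
Hypothesis alg : algebraic_over i.
Local Notation Gal := (Defs.gal i).

Lemma finite_orbit (e : seq L) :
  exists S : seq (seq L), forall s : Gal, map s e \in S.
Proof.
elim: e => [|a e [S SP]]; first by exists [:: [::]].
have [q q0 qa] := alg a.
have [|r rP] := @roots_seq L (map_poly i q); first by rewrite map_poly_eq0.
exists [seq b :: v | b <- r, v <- S] => s; apply: allpairs_f; last exact: SP.
apply: rP; rewrite -(fmorph_root s) in qa; apply: etrans qa; congr (root _ _).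
by rewrite -map_poly_comp; apply: eq_map_poly => c /=; rewrite gal_base.
Qed.

(** The field fixed by the open subgroup Gal(L / K(e)). *)
Definition fixed_by (e : seq L) (b : L) : Prop :=
  forall s : Gal, krull_coset 1%g e s -> s b = b.

(** The images of the tuple e under a subgroup H stand for the cosets of H modulo
    the stabilizer of e.  They form a finite set, which makes it possible to sum
    over H / H_e with a chosen representative for each image. *)
Section Average.
Variables (H : set Gal) (e : seq L).
Hypothesis Hsub : is_subgroup H.

(** One representative in H for each element of the H-orbit of e. *)
Lemma orbit_transversal :
  exists (S : seq (seq L)) (rep : seq L -> Gal),
    [/\ uniq S, forall v, v \in S -> H (rep v) /\ map (rep v) e = v
      & forall s, H s -> map s e \in S].
Proof.
have [S0 S0P] := finite_orbit e.
have /choice[rep repP] : forall v, exists s : Gal,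
    (exists2 t : Gal, H t & map t e = v) -> H s /\ map s e = v.
  move=> v; have [[s Hs sv]|no] := boolp.pselect (exists2 s : Gal, H s & map s e = v).
    by exists s.
  by exists 1%g.
exists (undup [seq v <- S0 | `[< exists2 s : Gal, H s & map s e = v >]]), rep.
split=> [|v|s Hs]; first exact: undup_uniq.
  by rewrite mem_undup mem_filter => /andP[/asboolP/repP].
by rewrite mem_undup mem_filter S0P andbT; apply/asboolP; exists s.
Qed.

Variables (S : seq (seq L)) (rep : seq L -> Gal).
Hypothesis S_uniq : uniq S.
Hypothesis repP : forall v, v \in S -> H (rep v) /\ map (rep v) e = v.
Hypothesis SP : forall s, H s -> map s e \in S.

(** Translation by t permutes the orbit of e. *)
Lemma sum_orbit_translate (F : Gal -> L) :
  (forall s t, H s -> H t -> map s e = map t e -> F s = F t) ->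
  forall t, H t -> \sum_(v <- S) F (t * rep v)%g = \sum_(v <- S) F (rep v).
Proof.
move=> FP t Ht; have [H1 HM HV] := Hsub.
have tS : {subset map (map t) S <= S}.
  move=> _ /mapP[v vS ->]; have [Hv {1}<-] := repP vS.
  by rewrite -map_comp; apply: (SP (HM _ _ Ht Hv)).
have perm_tS : perm_eq (map (map t) S) S.
  have uS : uniq (map (map t) S) by rewrite map_inj_uniq //; apply/inj_map/fmorph_inj.
  apply: uniq_perm => //; have [|_ eqS] := uniq_min_size uS tS; last by move=> v; rewrite eqS.
  by rewrite size_map.
rewrite -[RHS](perm_big _ perm_tS) big_map; apply: eq_big_seq => v vS.
have [Hv vE] := repP vS; have [Htv tvE] := repP (tS _ (map_f (map t) vS)).
apply: FP => //; first by apply: HM.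
by apply: etrans (esym tvE); rewrite -[X in map t X]vE -map_comp.
Qed.

(** Representatives of distinct elements of the orbit differ on some entry of e,
    and the entries of e are fixed by the stabilizer of e. *)
Lemma sum_orbit_neq0 (k : seq L -> L) : (forall v, k v != 0) ->
  exists2 b, fixed_by e b & \sum_(v <- S) k v * rep v b != 0.
Proof.
move=> k0; apply: contrapT => no.
have kS : {in S, forall v, k v = 0}.
  apply: (@dedekind_independence _ _ (fixed_by e) S (fun v => rep v : L -> L)) => //.
  - by move=> s _; rewrite rmorph1.
  - by move=> a b ae be s se; rewrite rmorphM; congr (_ * _); [exact: ae | exact: be].
  - by move=> v; rewrite rmorph1.
  - by move=> v a b _ _; rewrite rmorphM.
  - move=> u v uS vS uv; have [Hu uE] := repP uS; have [Hv vE] := repP vS.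
    apply: contrapT => no'; case/eqP: uv; rewrite -uE -vE; apply/eq_in_map => a ae.
    apply/eqP; apply: contrapT => /negP ne; apply: no'; exists a => // s se.
    by rewrite se // gal_oneE.
  move=> b be; apply/eqP; apply: contrapT => /negP ne; apply: no; by exists b.
have [H1 _ _] := Hsub.
by have /eqP := kS _ (SP H1); rewrite (negPf (k0 _)).
Qed.
End Average.
End Orbits.

(** * Hilbert 90 *)

Section PrimPower.
Variables (L : fieldType) (n : nat) (z : L).
Hypothesis n_gt1 : (1 < n)%N.
Hypothesis zP : n.-primitive_root z.

(** The isomorphism of Z/n with the group of n-th roots of unity given by z. *)
Definition zexp (a : 'Z_n) : L := z ^+ val a.

Lemma zexp_nat k : zexp k%:R = z ^+ k.
Proof. by rewrite /zexp /= val_Zp_nat // (prim_expr_mod zP). Qed.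

Lemma zexpD a b : zexp (a + b) = zexp a * zexp b.
Proof. by rewrite -[a]natr_Zp -[b]natr_Zp -natrD !zexp_nat exprD. Qed.

Lemma zexpM a b : zexp (a * b) = zexp a ^+ val b.
Proof. by rewrite -[a]natr_Zp -{1}[b]natr_Zp -natrM !zexp_nat exprM. Qed.

Lemma zexpMn a k : zexp (a *+ k) = zexp a ^+ k.
Proof. by elim: k => // k IH; rewrite mulrS zexpD IH exprS. Qed.

Lemma zexpN a : zexp (- a) * zexp a = 1.
Proof. by rewrite -zexpD addNr. Qed.

Lemma zexp_neq0 a : zexp a != 0.
Proof.
apply: expf_neq0; apply/eqP => z0; have /eqP := prim_expr_order zP.
by rewrite z0 expr0n gtn_eqF ?(ltnW n_gt1) // eq_sym oner_eq0.
Qed.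

Lemma zexp_inj : injective zexp.
Proof.
have lt_n (a : 'Z_n) : (a < n)%N by rewrite -[X in (_ < X)%N](Zp_cast n_gt1) ltn_ord.
by move=> a b /eqP; rewrite (eq_prim_root_expr zP) !modn_small ?lt_n // => /eqP/val_inj.
Qed.

Lemma zexp_log x : x ^+ n = 1 -> exists a, x = zexp a.
Proof. by move=> /(prim_rootP zP)[k ->]; exists (val k)%:R; rewrite zexp_nat. Qed.
End PrimPower.

Section Hilbert90.
Variables (K L : fieldType) (i : {rmorphism K -> L}) (p : nat).
Local Notation Gal := (Defs.gal i).
Hypothesis alg : algebraic_over i.
Hypothesis p_gt1 : (1 < p)%N.
Variables (H : set Gal) (e : seq L) (chi : Gal -> 'Z_p).
Hypothesis Hsub : is_subgroup H.
Hypothesis chiM : hom_on H chi.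
Hypothesis chi_e : forall s : Gal, krull_coset 1%g e s -> H s /\ chi s = 0.

(** Both chi and the action on elements fixed by the stabilizer of e factor through
    the orbit of e. *)
Lemma orbit_factor (s t : Gal) (b : L) : H s -> H t -> map s e = map t e ->
  fixed_by i e b -> chi s = chi t /\ s b = t b.
Proof.
move=> Hs Ht /eq_in_map st be; have [H1 HM HV] := Hsub.
have u1 : krull_coset 1%g e (s^-1 * t)%g.
  by move=> a ae; rewrite gal_mulE -st // gal_invK.
have [Hu chiu] := chi_e u1.
rewrite -[t](mulKVg s) chiM // chiu addr0; split=> //.
by rewrite gal_mulE (be _ u1).
Qed.

(** Lagrange resolvent: a is the sum of z^(-chi(s)) s(b) over the cosets of the
    stabilizer of e, for some b making it nonzero. *)
Lemma hilbert90 (z : L) : p.-primitive_root z -> (forall s : Gal, s z = z) ->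
  exists2 a : L, a != 0 & forall s, H s -> s a = zexp z (chi s) * a.
Proof.
move=> zP sz; have [H1 HM HV] := Hsub.
have [S [rep [uS repP SP]]] := orbit_transversal alg H e.
have [|b be] := sum_orbit_neq0 Hsub uS repP SP (k := fun v => zexp z (- chi (rep v))).
  by move=> v; apply: zexp_neq0.
set a := (X in X != 0) => a0; exists a => // t Ht.
rewrite [in RHS]/a -(sum_orbit_translate Hsub uS repP SP
  (F := fun s => zexp z (- chi s) * s b) _ Ht); last first.
  by move=> s u Hs Hu su; have [-> ->] := orbit_factor Hs Hu su be.
rewrite mulr_sumr rmorph_sum; apply: eq_big_seq => v /repP[Hv _].
rewrite rmorphM /= chiM // opprD zexpD // !mulrA.
rewrite [zexp z (chi t) * _]mulrC zexpN // mul1r; congr (_ * _).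
by rewrite /zexp rmorphXn; congr (_ ^+ _); exact: sz.
Qed.

(** With T the nonzero trace of b, the element -a/T works, where a is the sum of
    chi(s) s(b): translating by t replaces chi(s) by chi(s) - chi(t). *)
Lemma hilbert90_additive : p \in [pchar L] ->
  exists a : L, forall s, H s -> s a = a + (val (chi s))%:R.
Proof.
move=> charL; have [H1 HM HV] := Hsub.
have natD (c d : 'Z_p) : (val (c + d))%:R = (val c)%:R + (val d)%:R :> L.
  rewrite -natrD -[in LHS](GRing.natr_mod_pchar charL) -[in RHS](GRing.natr_mod_pchar charL).
  by rewrite -!(val_Zp_nat p_gt1) natrD !natr_Zp.
have [S [rep [uS repP SP]]] := orbit_transversal alg H e.
have [|b be] := sum_orbit_neq0 Hsub uS repP SP (k := fun v => 1).
  by move=> v; apply: oner_neq0.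
under eq_bigr => v _ do rewrite mul1r.
set T := (X in X != 0) => T0.
have sT t : H t -> t T = T.
  move=> Ht; rewrite [in RHS]/T -(sum_orbit_translate Hsub uS repP SP
    (F := fun s => s b) _ Ht).
    by rewrite rmorph_sum.
  by move=> s u Hs Hu su; have [_ ->] := orbit_factor Hs Hu su be.
pose a := \sum_(v <- S) (val (chi (rep v)))%:R * rep v b.
exists (- (T^-1 * a)) => t Ht.
have -> : t (- (T^-1 * a)) = - (T^-1 * t a).
  by rewrite rmorphN rmorphM fmorphV; congr (- (_^-1 * _)); exact: sT.
apply: (mulfI T0).
rewrite mulrN mulrDr mulrN !mulrA divff // !mul1r.
have -> : t a = a - (val (chi t))%:R * T; last by rewrite mulrC opprB addrC.
rewrite [in RHS]/a -(sum_orbit_translate Hsub uS repP SP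
  (F := fun s => (val (chi s))%:R * s b) _ Ht); last first.
  by move=> s u Hs Hu su; have [-> ->] := orbit_factor Hs Hu su be.
rewrite -[in RHS](sT t Ht) !rmorph_sum mulr_sumr -sumrB; apply: eq_big_seq => v /repP[Hv _].
by rewrite rmorphM rmorph_nat chiM // natD mulrDl addrAC subrr add0r.
Qed.
End Hilbert90.

(** * The Kummer lifting property *)

Section Bockstein.
Variable p : nat.
Hypothesis p_gt1 : (1 < p)%N.

(** The embedding of Z/p in Z/p^2 as the subgroup of multiples of p. *)
Definition mulp (a : 'Z_p) : 'Z_(p ^ 2) := (p * val a)%:R.

Lemma p2_gt1 : (1 < p ^ 2)%N.
Proof. by rewrite expnS expn1 (leq_trans p_gt1) // leq_pmulr // ltnW. Qed.

Lemma mulp_nat k : mulp k%:R = (p * k)%:R.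
Proof.
by rewrite /mulp /= val_Zp_nat // muln_modr -[RHS]Zp_nat_mod ?p2_gt1 // -mulnn.
Qed.

Lemma mulpD a b : mulp (a + b) = mulp a + mulp b.
Proof. by rewrite -[a]natr_Zp -[b]natr_Zp -natrD !mulp_nat mulnDr natrD. Qed.

Lemma mulp0 : mulp 0 = 0.
Proof. by rewrite /mulp muln0. Qed.

Lemma mulp_inj : injective mulp.
Proof.
have lt_p (a : 'Z_p) : (val a < p)%N by rewrite -[X in (_ < X)%N](Zp_cast p_gt1) ltn_ord.
move=> a b /(congr1 val); rewrite /= !val_Zp_nat ?p2_gt1 //.
rewrite !modn_small -?mulnn ?ltn_pmul2l ?lt_p ?(ltnW p_gt1) // => /eqP.
by rewrite eqn_pmul2l ?(ltnW p_gt1) // => /eqP/val_inj.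
Qed.
End Bockstein.

(** The function e is a lift to Z/p^2 of the homomorphism chi on H, in the form
    p e = p chi, and a crossed homomorphism for the action of s as 1 + p m(s): the
    term mulp (m s * chi t) is p m(s) e(t). *)
Definition kummer_lifting (p : nat) (G : topGroupType) (m : G -> 'Z_p) : Prop :=
  forall (H : set G) (chi : G -> 'Z_p), is_subgroup H -> hom_on H chi ->
    open [set s | H s /\ chi s = 0] ->
    exists e : G -> 'Z_(p ^ 2), forall t, H t ->
       e t *+ p = mulp (chi t) /\
       forall s, H s -> e (s * t)%g = e s + e t + mulp (m s * chi t).

(** The 1-smoothness of pro-p groups, restricted to coefficients in Z/p^2. *)
Definition kummerian (p : nat) (G : topGroupType) : Prop :=
  exists2 m : G -> 'Z_p, hom_on setT m & kummer_lifting m.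

Section Kummer.
Variables (K L : fieldType) (i : {rmorphism K -> L}) (p : nat) (z : L).
Local Notation Gal := (Defs.gal i).
Hypothesis alg : algebraic_over i.
Hypothesis p_pr : prime p.
Hypothesis zP : p.-primitive_root z.
Hypothesis sz : forall s : Gal, s z = z.
Hypothesis pth_root : forall a : L, exists b, b ^+ p = a.

Lemma open_sub_krull_coset (U : set Gal) : open U -> U 1%g ->
  exists e : seq L, krull_coset (1%g : Gal) e `<=` U.
Proof. by move=> oU U1; apply: nbhs_krullP; apply: open_nbhs_nbhs. Qed.

(** The homomorphism m is the Kummer character of z: s(w) = w z^m(s) with w^p = z.
    The crossed homomorphism is the logarithm to the base w of s(b)/b, where b^p is
    the element provided by Hilbert 90. *)
Theorem gal_kummerian : kummerian p Gal.
Proof.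
have p_gt1 := prime_gt1 p_pr; have p2gt1 := p2_gt1 p_gt1.
have [w wp] := pth_root z.
have wP : (p ^ 2).-primitive_root w.
  have : w ^+ (p ^ 2) = 1 by rewrite exprM wp (prim_expr_order zP).
  case/(prim_order_exists (ltnW p2gt1)) => d dP.
  case/(dvdn_pfactor _ _ p_pr) => k k2 dE; move: dP; rewrite dE.
  move: k2; rewrite leq_eqVlt => /predU1P[->//|].
  rewrite ltnS => k1 kP; have w1 : w ^+ p = 1.
    by apply/eqP; rewrite -(prim_order_dvd kP) -{2}(expn1 p) dvdn_exp2l.
  have := prim_order_dvd zP 1; rewrite -wp w1 expr1n eqxx dvdn1.
  by rewrite gtn_eqF.
have logp (x : L) : x ^+ p = 1 -> exists a : 'Z_p, x = zexp z a by exact: (zexp_log p_gt1 zP).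
have [m mE] : exists m : Gal -> 'Z_p, forall s : Gal, s w = w * zexp z (m s).
  suff /choice[m mE] : forall s : Gal, exists a : 'Z_p, s w / w = zexp z a.
    by exists m => s; rewrite -mE mulrC divfK // -[w](zexp_nat p2gt1 wP 1) ?zexp_neq0.
  move=> s; apply: logp; rewrite expr_div_n -gal_funX wp sz divff //.
  by rewrite -[z](zexp_nat p_gt1 zP 1) zexp_neq0.
have w0 : w != 0 by rewrite -[w](zexp_nat p2gt1 wP 1) zexp_neq0.
have szexp (s : Gal) (c : 'Z_p) : s (zexp z c) = zexp z c by rewrite /zexp gal_funX sz.
have mM : hom_on setT m.
  move=> s t _ _; apply: (zexp_inj p_gt1 zP); apply: (mulfI w0).
  by rewrite -mE gal_mulE mE gal_funM mE szexp zexpD // mulrA.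
exists m => // H chi Hsub chiM openU; have [H1 HM HV] := Hsub.
have chi1 : chi 1%g = 0.
  by apply: (addrI (chi 1%g)); rewrite -chiM // mulg1 addr0.
have [|e eU] := @open_sub_krull_coset _ openU; first by split.
have [a a0 aE] := hilbert90 alg p_gt1 Hsub chiM eU zP sz.
have [b bp] := pth_root a.
have b0 : b != 0.
  by apply: contraNneq a0 => b0; rewrite -bp b0 expr0n gtn_eqF // ltnW.
have zw (c : 'Z_p) : zexp w (mulp c) = zexp z c.
  by rewrite zexp_nat // exprM wp.
have Xp s : H s -> (s b / b) ^+ p = zexp z (chi s).
  by move=> Hs; rewrite expr_div_n -gal_funX bp aE // mulfK.
have [E EP] : exists E : Gal -> 'Z_(p ^ 2), forall s, H s -> s b = b * zexp w (E s).
  suff /choice[E EP] : forall s : Gal, exists c : 'Z_(p ^ 2), H s -> s b / b = zexp w c.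
    by exists E => s Hs; rewrite -EP // mulrC divfK.
  move=> s; have [Hs|nHs] := boolp.pselect (H s); last by exists 0.
  have [|c ->] := zexp_log p2gt1 wP (x := s b / b); last by exists c.
  by rewrite exprM Xp // -zexpMn // -[_ *+ p]mulr_natr pchar_Zp // mulr0.
exists E => t Ht.
have Et : zexp w (E t *+ p) = zexp z (chi t).
  by rewrite -Xp // EP // mulrC mulKf // zexpMn.
split; first by apply: (zexp_inj p2gt1 wP); rewrite zw.
move=> s Hs; apply: (zexp_inj p2gt1 wP); apply: (mulfI b0).
rewrite -EP; last exact: HM.
rewrite gal_mulE EP // gal_funM EP // -mulrA; congr (_ * _).
rewrite -addrA zexpD //; congr (_ * _).
rewrite zexpD // zw {1}/zexp gal_funX mE exprMn -/(zexp w (E t)); congr (_ * _).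
(* Only the residue of E t modulo p, that is chi t, matters for s(w)/w, which has
   order p. *)
rewrite [m s * _]mulrC zexpM // -Et zexpMn // /zexp [LHS]exprAC -wp.
by congr (_ ^+ _); rewrite exprAC.
Qed.
End Kummer.

(** * Artin-Schreier theory and cup products *)

Section CharP.
Variables (L : fieldType) (p : nat).
Hypothesis charL : p \in [pchar L].

Let p_pr : prime p. Proof. exact: pcharf_prime charL. Qed.
Let p_gt1 : (1 < p)%N. Proof. exact: prime_gt1. Qed.

Definition fp_embed (a : 'Z_p) : L := (val a)%:R.

Lemma fp_embed_nat k : fp_embed k%:R = k%:R.
Proof. by rewrite /fp_embed /= val_Zp_nat // (GRing.natr_mod_pchar charL). Qed.

Lemma fp_embedD a b : fp_embed (a + b) = fp_embed a + fp_embed b.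
Proof. by rewrite -[a]natr_Zp -[b]natr_Zp -natrD !fp_embed_nat natrD. Qed.

Lemma natr_expp k : k%:R ^+ p = k%:R :> L.
Proof. exact: (rmorph_nat (pFrobenius_aut charL) k). Qed.

Lemma expp_sub (a b : L) : (a - b) ^+ p = a ^+ p - b ^+ p.
Proof. exact: (rmorphB (pFrobenius_aut charL)). Qed.

Lemma expp_add (a b : L) : (a + b) ^+ p = a ^+ p + b ^+ p.
Proof. exact: (rmorphD (pFrobenius_aut charL)). Qed.

(** The polynomial X^p - X has at most p roots, and the p elements of the prime field
    are roots. *)
Lemma expp_fixed (c : L) : c ^+ p = c -> exists k, c = k%:R.
Proof.
move=> cp; apply: contrapT => no.
pose q : {poly L} := 'X^p - 'X.
have qn (a : L) : a ^+ p = a -> root q a by move=> ap; rewrite /root !hornerE ap subrr.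
have sq : size q = p.+1.
  by rewrite size_addl ?size_polyXn // size_opp size_polyX ltnS.
pose rs := c :: [seq k%:R | k <- iota 0 p].
have q0 : q != 0 by rewrite -size_poly_eq0 sq.
have := max_poly_roots q0 (rs := rs); rewrite sq /= size_map size_iota ltnn => h.
suff : false by []; apply: h.
  rewrite qn // all_map; apply/allP => k _; apply: qn; exact: natr_expp.
apply/andP; split; first by apply/negP => /mapP[k _ ck]; apply: no; exists k.
rewrite map_inj_in_uniq ?iota_uniq // => k l.
rewrite !mem_iota !add0n /= => kp lp /eqP.
wlog lek : k l kp lp / (l <= k)%N.
  by move=> W; case: (leqP l k) => [|/ltnW] lk; [exact: W | rewrite eq_sym => kl; apply/esym/W].
rewrite -subr_eq0 -natrB // -(GRing.dvdn_pcharf charL).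
by case: (posnP (k - l)) => [|kl /(dvdn_leq kl)]; lia.
Qed.
End CharP.

(** In H^2 with coefficients in L, on which G acts trivially; the 2-cocycle
    chi1(s) chi2(t) is the coboundary of -psi. *)
Definition cup_products_vanish (p : nat) (L : fieldType) (G : topGroupType) : Prop :=
  forall chi1 chi2 : G -> 'Z_p, hom_on setT chi1 -> hom_on setT chi2 ->
    open [set s | chi1 s = 0] -> open [set s | chi2 s = 0] ->
    exists psi : G -> L, forall s t,
      psi (s * t)%g = psi s + psi t + fp_embed L (chi1 s) * fp_embed L (chi2 t).

Section ArtinSchreier.
Variables (K L : fieldType) (i : {rmorphism K -> L}) (p : nat).
Local Notation Gal := (Defs.gal i).
Hypothesis alg : algebraic_over i.
Hypothesis charL : p \in [pchar L].
Hypothesis as_root : forall c : L, exists b, b ^+ p - b = c.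

(** Write chi_i(s) = s(a_i) - a_i.  The cochain s -> chi1(s) s(a2) has coboundary
    -chi1(s) chi2(t), but its values lie in L.  Applying X^p - X to it gives
    chi1(s) (a2^p - a2), the coboundary of a1 (a2^p - a2); if b^p - b is this last
    element, then subtracting s(b) - b leaves values in the prime field. *)
Theorem gal_cup_products_vanish : cup_products_vanish p L Gal.
Proof.
move=> chi1 chi2 chi1M chi2M open1 open2.
have p_gt1 := prime_gt1 (pcharf_prime charL).
have setTG : is_subgroup [set: Gal] by split.
have split_chi (chi : Gal -> 'Z_p) : hom_on setT chi -> open [set s | chi s = 0] ->
    exists a : L, forall s : Gal, s a = a + fp_embed L (chi s).
  move=> chiM chi_open.
  have [|e eU] := @open_sub_krull_coset _ _ i _ chi_open.
    by apply: (addrI (chi 1%g)); rewrite -chiM // mulg1 addr0.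
  have [|a aP] := hilbert90_additive alg p_gt1 setTG chiM (e := e) _ charL.
    by move=> s se; split=> //; exact: eU.
  by exists a => s; apply: aP.
have [a1 a1E] := split_chi _ chi1M open1.
have [a2 a2E] := split_chi _ chi2M open2.
have [b bE] := as_root (a1 * (a2 ^+ p - a2)).
have sD (s : Gal) u v : s (u + v) = s u + s v by exact: rmorphD.
have sB (s : Gal) u v : s (u - v) = s u - s v by exact: rmorphB.
have sn (s : Gal) a : s (fp_embed L a) = fp_embed L a by exact: rmorph_nat.
have fpp (c : 'Z_p) : fp_embed L c ^+ p = fp_embed L c by exact: natr_expp.
pose psi (s : Gal) := fp_embed L (chi1 s) * s a2 - (s b - b).
have psi_fixed (s t : Gal) : s (psi t) = psi t.
  have [|k ->] := expp_fixed charL (c := psi t); last exact: rmorph_nat.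
  apply/eqP; rewrite -subr_eq0; apply/eqP.
  rewrite /psi !(expp_sub charL) exprMn fpp -!gal_funX.
  have tb := congr1 t bE; rewrite sB gal_funM sB a1E in tb.
  have -> : t (b ^+ p) = t b + (a1 + fp_embed L (chi1 t)) * (t (a2 ^+ p) - t a2).
    by rewrite -tb; ring.
  have ta : t (a2 ^+ p) - t a2 = a2 ^+ p - a2.
    by rewrite gal_funX a2E (expp_add charL) fpp; ring.
  have -> : t (a2 ^+ p) = t a2 + (a2 ^+ p - a2) by rewrite -ta; ring.
  have -> : b ^+ p = b + a1 * (a2 ^+ p - a2) by rewrite -bE; ring.
  by ring.
exists psi => s t.
rewrite -[in RHS](psi_fixed s t) /psi sB gal_funM sn sB.
rewrite chi1M // fp_embedD // !gal_mulE a2E sD sn.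
by ring.
Qed.
End ArtinSchreier.

(** * Finite p-groups as pro-p groups *)

Section Discrete.
Local Open Scope group_scope.

(** A copy of P, to carry the discrete topology. *)
Definition discrete_group (P : finGroupType) : Type := P.

HB.instance Definition _ (P : finGroupType) :=
  FinGroup.copy (discrete_group P) P.
HB.instance Definition _ (P : finGroupType) :=
  hasNbhs.Build (discrete_group P) principal_filter.
HB.instance Definition _ (P : finGroupType) :=
  Discrete_ofNbhs.Build (discrete_group P) erefl.

Lemma discrete_mulg_continuous (P : finGroupType) :
  continuous (fun z : discrete_group P * discrete_group P => z.1 * z.2).
Proof.
move=> [a b] A /nbhs_singleton /= Aab.
exists ([set a], [set b]); first by split; exact: discrete_set1.
by move=> [a' b'] /= [-> ->].
Qed.

Lemma discrete_invg_continuous (P : finGroupType) :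
  continuous (fun x : discrete_group P => x^-1).
Proof.
move=> a A /nbhs_singleton Aa.
by apply: (@filterS _ (nbhs a) _ [set a]) (discrete_set1 a) => b ->.
Qed.

HB.instance Definition _ (P : finGroupType) :=
  isTopologicalGroup.Build (discrete_group P)
    (@discrete_mulg_continuous P) (@discrete_invg_continuous P).

Lemma pro_p_discrete (p : nat) (P : finGroupType) :
  p.-group [set: discrete_group P]%SET -> pro_p p (discrete_group P).
Proof.
move=> pP; split.
  split.
  - apply: finite_compact; exact: (@finite_finset P _).
  - exact: discrete_hausdorff.
  - exact/zero_dimension_totally_disconnected/discrete_zero_dimension.
move=> N [[N1 NM NV] _] _.
pose A := [set g : discrete_group P | `[< N g >]]%SET.
have AP g : reflect (N g) (g \in A) by rewrite inE; apply: asboolP.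
have gA : group_set A.
  apply/group_setP; split; first exact/AP.
  by move=> g h /AP Ng /AP Nh; apply/AP/NM.
have /p_natP[n nE] : p.-nat #|[set: discrete_group P]%SET : Group gA|.
  by apply: pnat_dvd pP; apply: dvdn_indexg.
exists n; rewrite -nE -card_lcosets.
set C := lcosets _ _; pose f (k : 'I_#|C|) : set (discrete_group P) := [set` enum_val k].
have f_inj : injective f.
  move=> k l fkl; apply: enum_val_inj; apply/setP => g.
  apply/idP/idP => gk; first by have : f l g by rewrite -fkl.
  by have : f k g by rewrite fkl.
have -> : lcosets_of N = f @` setT.
  apply/seteqP; split=> [_ [g _ <-]|_ [k _ <-]].
    have gC : (g *: A)%g \in C by apply/lcosetsP; exists g; rewrite ?inE.
    exists (enum_rank_in gC (g *: A)%g) => //; rewrite /f enum_rankK_in //.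
    apply/seteqP; split=> [h /lcosetP[u /AP Nu ->]|h [u Nu <-]]; first by exists u.
    by apply/lcosetP; exists u => //; apply/AP.
  have /lcosetsP[g _ gE] := enum_valP k; exists g => //; rewrite /f gE.
  apply/seteqP; split=> [h [u Nu <-]|h /lcosetP[u /AP Nu ->]]; last by exists u.
  by apply/lcosetP; exists u => //; apply/AP.
apply: card_eq_trans (card_esym card_II).
by apply: inj_card_eq => k l _ _ /f_inj.
Qed.
End Discrete.

(** * Heisenberg groups and finite quotients of a presented group *)

Section Heisenberg.
Variable p : nat.

(** The Heisenberg group of order p^5, of tuples (a1, b1, a2, b2, c): the commutator
    of two elements is central, with c given by the standard symplectic form. *)
Definition heis : Type := ('Z_p * 'Z_p * 'Z_p * 'Z_p * 'Z_p)%type.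

Definition Heis a1 b1 a2 b2 c : heis := (a1, b1, a2, b2, c).

Definition heis_mul (g h : heis) : heis :=
  let: (a1, b1, a2, b2, c) := g in
  let: (a1', b1', a2', b2', c') := h in
  Heis (a1 + a1') (b1 + b1') (a2 + a2') (b2 + b2') (c + c' + a1 * b1' + a2 * b2').
Definition heis_one : heis := Heis 0 0 0 0 0.
Definition heis_inv (g : heis) : heis :=
  let: (a1, b1, a2, b2, c) := g in
  Heis (- a1) (- b1) (- a2) (- b2) (- c + a1 * b1 + a2 * b2).

Lemma heis_mulA : associative heis_mul.
Proof.
move=> [[[[a1 b1] a2] b2] c] [[[[a1' b1'] a2'] b2'] c'] [[[[a1'' b1''] a2''] b2''] c''].
by rewrite /heis_mul /Heis; congr (_, _, _, _, _); ring.
Qed.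
Lemma heis_mul1 : left_id heis_one heis_mul.
Proof.
move=> [[[[a1 b1] a2] b2] c].
by rewrite /heis_mul /Heis /=; congr (_, _, _, _, _); ring.
Qed.
Lemma heis_mulV : left_inverse heis_one heis_inv heis_mul.
Proof.
move=> [[[[a1 b1] a2] b2] c].
by rewrite /heis_mul /Heis /=; congr (_, _, _, _, _); ring.
Qed.

HB.instance Definition _ := Finite.copy heis ('Z_p * 'Z_p * 'Z_p * 'Z_p * 'Z_p)%type.
HB.instance Definition _ := Finite_isGroup.Build heis heis_mulA heis_mul1 heis_mulV.

Definition heis_a1 (g : heis) : 'Z_p := g.1.1.1.1.
Definition heis_b1 (g : heis) : 'Z_p := g.1.1.1.2.
Definition heis_a2 (g : heis) : 'Z_p := g.1.1.2.
Definition heis_c (g : heis) : 'Z_p := g.2.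

Lemma heis_mulE (a1 b1 a2 b2 c a1' b1' a2' b2' c' : 'Z_p) :
  (Heis a1 b1 a2 b2 c * Heis a1' b1' a2' b2' c')%g =
  Heis (a1 + a1') (b1 + b1') (a2 + a2') (b2 + b2') (c + c' + a1 * b1' + a2 * b2').
Proof. by []. Qed.

Lemma heis_invE (a1 b1 a2 b2 c : 'Z_p) :
  (Heis a1 b1 a2 b2 c)^-1%g =
  Heis (- a1) (- b1) (- a2) (- b2) (- c + a1 * b1 + a2 * b2).
Proof. by []. Qed.

Lemma heis_oneE : (1%g : heis) = Heis 0 0 0 0 0.
Proof. by []. Qed.

Lemma heis_commE (a1 b1 a2 b2 c a1' b1' a2' b2' c' : 'Z_p) :
  [~ Heis a1 b1 a2 b2 c, Heis a1' b1' a2' b2' c']%g =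
  Heis 0 0 0 0 (a1 * b1' - a1' * b1 + (a2 * b2' - a2' * b2)).
Proof.
rewrite /commg /conjg !heis_invE !heis_mulE /Heis.
by congr (_, _, _, _, _); ring.
Qed.

Lemma heis_pgroup : prime p -> (p.-group [set: heis]%SET)%g.
Proof.
move=> p_pr; rewrite /pgroup cardsT !card_prod !card_ord Zp_cast ?prime_gt1 //.
by rewrite !pnatM pnat_id.
Qed.

Lemma heis_expE (a1 b1 a2 b2 c : 'Z_p) k :
  (Heis a1 b1 a2 b2 c ^+ k)%g =
  Heis (a1 *+ k) (b1 *+ k) (a2 *+ k) (b2 *+ k) (c *+ k + (a1 * b1 + a2 * b2) *+ 'C(k, 2)).
Proof.
elim: k => [|k IH]; first by rewrite !mulr0n addr0.
rewrite expgS IH heis_mulE binS bin1 mulrnDr !mulrS; congr Heis.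
by rewrite !mulrnAr -[LHS]addrA -mulrnDl !addrA.
Qed.

(** For odd p the binomial coefficient C(p, 2) is divisible by p, so that the group
    has exponent p. *)
Lemma heis_expp (g : heis) : prime p -> odd p -> (g ^+ p = 1)%g.
Proof.
move=> p_pr p_odd; case: g => [[[[a1 b1] a2] b2] c].
have mulp_Zp (a : 'Z_p) k : (p %| k)%N -> a *+ k = 0.
  move=> /dvdnP[q ->]; by rewrite mulrnA -[LHS]mulr_natr pchar_Zp ?mulr0 ?prime_gt1.
rewrite -[LHS]/(Heis a1 b1 a2 b2 c ^+ p)%g heis_expE !mulp_Zp ?addr0 //.
by rewrite prime_dvd_bin // ltnNge -ltnS; case: (p) p_pr p_odd => [|[|[|]]].
Qed.
End Heisenberg.

Section Presentation.
Local Open Scope group_scope.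
(** The universal property of the free pro-p group gives a homomorphism from F to
    P, viewed as a discrete pro-p group; its kernel is closed and normal and contains
    R, so it factors through G.  The factor is locally constant because F is compact
    and G is Hausdorff: images of closed sets are closed. *)
Lemma presentation_lift (p : nat) (X : finType) (F : topGroupType) (iota : X -> F)
  (R : set F) (G : topGroupType) :
  pro_p_presentation p iota R G ->
  exists pi : F -> G, {morph pi : u v / u * v} /\ (forall r, R r -> pi r = 1) /\
    forall (P : finGroupType), p.-group [set: P]%SET -> forall h : X -> P,
      (forall f : F -> P, {morph f : u v / u * v} -> (forall a, f (iota a) = h a) ->
        forall r, R r -> f r = 1) ->
      exists rho : G -> P, [/\ {morph rho : u v / u * v},
        forall C : set P, open (rho @^-1` C)
        & forall a, rho (pi (iota a)) = h a].
Proof.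
move=> [[Fp free] [[Gc Gh _] _] [pi [[pi_c piM] pi_surj piK]]].
exists pi; split=> //; split=> [r Rr|P pP h hR].
  by apply/piK => N _ _; apply.
have [f [[[f_c fM] fh] _]] := free (discrete_group P) (pro_p_discrete pP) h.
have f1 := hom_morph1 fM; have fV := hom_morphV fM.
have f_closed D : closed (f @^-1` D).
  by have /continuous_closedP := f_c; apply; exact: (@discrete_closed (discrete_group P)).
have fR := hR f fM fh.
have fker u : pi u = 1 -> f u = 1.
  move/piK/(_ (f @^-1` [set 1])); apply.
  - split; last by move=> v w /= v1; rewrite /conjg !fM v1 mul1g fV mulVg.
    split=> [|v w /= v1 w1|v /= v1] //=; first by rewrite fM v1 w1 mulg1.
    by rewrite fV v1 invg1.
  - exact: f_closed.
  by move=> r Rr; exact: fR.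
have [lift liftP] := choice pi_surj.
have liftE u : f (lift (pi u)) = f u.
  apply/eqP; rewrite eq_mulgV1 -fV -fM; apply/eqP/fker.
  by rewrite piM (hom_morphV piM) liftP mulgV.
exists (f \o lift); split=> [u v|C|a] /=; last by rewrite liftE fh.
  by rewrite -[in LHS](liftP u) -[in LHS](liftP v) -piM liftE fM.
rewrite -[X in open X]setCK openC.
have -> : ~` ((f \o lift) @^-1` C) = pi @` (f @^-1` (~` C)).
  apply/seteqP; split=> [g Cg|_ [u Cu <-]]; first by exists (lift g).
  by rewrite /= liftE.
have [Fcomp _ _] := Fp.1.
apply: compact_closed => //; apply: continuous_compact.
  by apply: continuous_subspaceT.
exact: subclosed_compact (f_closed _) Fcomp _.
Qed.
End Presentation.

(** * Lifts to the Heisenberg group *)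

Section Heis.
Variable p : nat.
Hypothesis p_gt1 : (1 < p)%N.

Definition heis_axis (a : 'Z_p) : heis p := Heis a 0 0 0 0.

Lemma heis_axis_comm a b : [~ heis_axis a, heis_axis b]%g = 1%g.
Proof. by rewrite heis_commE !(mulr0, mul0r) subr0 addr0. Qed.

Lemma comm_tail_trivial (G : groupType) d (y : nat -> G) :
  (forall i, (0 < i)%N -> [~ y i.*2, y i.*2.+1]%g = 1%g) -> comm_tail d y = 1%g.
Proof. by move=> y1; rewrite /comm_tail big_nat big1 // => i /andP[/y1]. Qed.

Lemma relator_a_heis_axis d a (b : nat -> 'Z_p) :
  relator_a d (heis_axis a) (fun k => heis_axis (b k)) = 1%g.
Proof.
rewrite /relator_a heis_axis_comm mul1g comm_tail_trivial // => i _; exact: heis_axis_comm.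
Qed.

Lemma relator_b_heis_axis d a (b : nat -> 'Z_p) :
  relator_b p d (heis_axis a) (fun k => heis_axis (b k)) = 1%g.
Proof.
rewrite /relator_b heis_axis_comm mulg1 comm_tail_trivial => [|i _]; last exact: heis_axis_comm.
rewrite mulg1 heis_expE !(mul0r, addr0, mul0rn).
by rewrite -[b 1%N *+ p]mulr_natr pchar_Zp // mulr0 mul0rn addr0.
Qed.

Lemma heis_a1M (g h : heis p) : heis_a1 (g * h)%g = heis_a1 g + heis_a1 h.
Proof. by case: g h => [[[[a1 b1] a2] b2] c] [[[[a1' b1'] a2'] b2'] c']. Qed.
Lemma heis_b1M (g h : heis p) : heis_b1 (g * h)%g = heis_b1 g + heis_b1 h.
Proof. by case: g h => [[[[a1 b1] a2] b2] c] [[[[a1' b1'] a2'] b2'] c']. Qed.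
Lemma heis_a2M (g h : heis p) : heis_a2 (g * h)%g = heis_a2 g + heis_a2 h.
Proof. by case: g h => [[[[a1 b1] a2] b2] c] [[[[a1' b1'] a2'] b2'] c']. Qed.
Lemma heis_cM (g h : heis p) : heis_b1 h = 0 -> heis_a2 g = 0 ->
  heis_c (g * h)%g = heis_c g + heis_c h.
Proof.
case: g h => [[[[a1 b1] a2] b2] c] [[[[a1' b1'] a2'] b2'] c'].
rewrite /heis_b1 /heis_a2 /= => -> ->.
by rewrite /heis_c /= mulr0 mul0r !addr0.
Qed.
End Heis.

Section Lifts.
Variables (p : nat) (G : topGroupType).

Definition heis_lifts (d1 d2 : nat) (x : G) (y z : nat -> G)
    (P : heis p -> (nat -> heis p) -> (nat -> heis p) -> Prop) : Prop :=
  forall hx hy hz, P hx hy hz ->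
    exists rho : G -> heis p,
      [/\ {morph rho : s t / (s * t)%g}, forall C, open (rho @^-1` C), rho x = hx,
          forall k, (1 <= k <= d1)%N -> rho (y k) = hy k
        & forall k, (1 <= k <= d2)%N -> rho (z k) = hz k].

Definition relators_a d1 d2 (hx : heis p) hy hz : Prop :=
  relator_a d1 hx hy = 1%g /\ relator_a d2 hx hz = 1%g.
Definition relators_b d1 d2 (hx : heis p) hy hz : Prop :=
  relator_b p d1 hx hy = 1%g /\ relator_b p d2 hx hz = 1%g.

(** The subgroup of the elements (a, 0, 0, 0, 0) is isomorphic to Z/p, so this says
    that a homomorphism to Z/p with open kernel can be prescribed on x and the y_k. *)
Definition axis_lifts (d : nat) (x : G) (y : nat -> G) : Prop :=
  forall a (b : nat -> 'Z_p), exists rho : G -> heis p,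
    [/\ {morph rho : s t / (s * t)%g}, forall C, open (rho @^-1` C), rho x = heis_axis a
      & forall k, (1 <= k <= d)%N -> rho (y k) = heis_axis (b k)].

Lemma heis_lifts_axis d1 d2 x y z
    (P : heis p -> (nat -> heis p) -> (nat -> heis p) -> Prop) :
  (forall a (b c : nat -> 'Z_p),
     P (heis_axis a) (fun k => heis_axis (b k)) (fun k => heis_axis (c k))) ->
  heis_lifts d1 d2 x y z P -> axis_lifts d1 x y /\ axis_lifts d2 x z.
Proof.
move=> Pabc lift; split=> a b.
  by have [rho [? ? ? ? _]] := lift _ _ _ (Pabc a b (fun=> 0)); exists rho.
by have [rho [? ? ? _ ?]] := lift _ _ _ (Pabc a (fun=> 0) b); exists rho.
Qed.

Lemma relators_a_axis d1 d2 a (b c : nat -> 'Z_p) : relators_a d1 d2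
  (heis_axis a) (fun k => heis_axis (b k)) (fun k => heis_axis (c k)).
Proof. by split; exact: relator_a_heis_axis. Qed.

Lemma relators_b_axis d1 d2 a (b c : nat -> 'Z_p) : (1 < p)%N ->
  relators_b d1 d2
    (heis_axis a) (fun k => heis_axis (b k)) (fun k => heis_axis (c k)).
Proof. by move=> p_gt1; split; exact: relator_b_heis_axis. Qed.
End Lifts.
Arguments relators_a p d1 d2 : clear implicits.
Arguments relators_b p d1 d2 : clear implicits.

(** * Crossed homomorphisms on relators *)

(** A function c whose coboundary is a bilinear form B.  Two cases occur: crossed
    homomorphisms lifting chi, with B(s, t) = p m(s) chi(t), and the cochains psi
    of Artin-Schreier theory, with B(s, t) = chi1(s) chi2(t).  On commutators c is
    the alternating form attached to B, and B vanishes there. *)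
Section BilinearCocycle.
Variables (G : groupType) (V : zmodType) (B : G -> G -> V) (c : G -> V).
Hypothesis BMl : forall s t u, B (s * t)%g u = B s u + B t u.
Hypothesis BMr : forall s t u, B u (s * t)%g = B u s + B u t.
Hypothesis cM : forall s t, c (s * t)%g = c s + c t + B s t.

Lemma bilin1l u : B 1%g u = 0.
Proof. by apply: (addrI (B 1%g u)); rewrite -BMl mulg1 addr0. Qed.
Lemma bilin1r u : B u 1%g = 0.
Proof. by apply: (addrI (B u 1%g)); rewrite -BMr mulg1 addr0. Qed.
Lemma bilin_commr s t u : B u [~ s, t]%g = 0.
Proof.
by apply: (addrI (B u (t * s)%g)); rewrite -BMr -commgC !BMr addr0 addrC.
Qed.

Lemma cocycle1 : c 1%g = 0.
Proof. by apply: (addrI (c 1%g)); rewrite -[in RHS](mulg1 1%g) cM bilin1l !addr0. Qed.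

Lemma cocycle_comm s t : c [~ s, t]%g = B s t - B t s.
Proof.
have := cM (t * s)%g [~ s, t]%g; rewrite -commgC bilin_commr addr0 !cM => h.
apply: (addrI (c t + c s + B t s)); rewrite -h.
by rewrite [B s t - _]addrC addrA addrK [c s + c t]addrC.
Qed.

Lemma cocycle_expg s n : B s s = 0 -> c (s ^+ n)%g = c s *+ n.
Proof.
move=> Bs; have Bsn m : B s (s ^+ m)%g = 0.
  by elim: m => [|m IH]; rewrite ?expg0 ?bilin1r // expgS BMr Bs IH addr0.
elim: n => [|n IH]; first by rewrite expg0 cocycle1.
by rewrite expgS cM Bsn IH addr0 mulrS.
Qed.

Lemma cocycle_comm_tail d (y : nat -> G) :
  (forall u, B u (comm_tail d y) = 0) /\
  c (comm_tail d y) =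
    \sum_(1 <= i < (d./2).+1) (B (y i.*2) (y i.*2.+1) - B (y i.*2.+1) (y i.*2)).
Proof.
pose P (g : G) (v : V) := (forall u, B u g = 0) /\ c g = v.
rewrite -/(P _ _) /comm_tail; apply: (big_ind2 P).
- by split; [exact: bilin1r | exact: cocycle1].
- move=> g v h w [Bg cg] [Bh ch]; split=> [u|]; first by rewrite BMr Bg Bh addr0.
  by rewrite cM Bh addr0 cg ch.
by move=> j _; split=> [u|]; rewrite ?bilin_commr ?cocycle_comm.
Qed.

Lemma cocycle_relator_a d x (y : nat -> G) :
  c (relator_a d x y) = B x (y 1%N) - B (y 1%N) x +
    \sum_(1 <= i < (d./2).+1) (B (y i.*2) (y i.*2.+1) - B (y i.*2.+1) (y i.*2)).
Proof.
have [Bt ct] := cocycle_comm_tail d y.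
by rewrite /relator_a cM Bt addr0 ct cocycle_comm.
Qed.

Lemma cocycle_relator_b p d x (y : nat -> G) : B (y 1%N) (y 1%N) = 0 ->
  c (relator_b p d x y) = c (y 1%N) *+ p + (B (y 1%N) x - B x (y 1%N)) +
    \sum_(1 <= i < (d./2).+1) (B (y i.*2) (y i.*2.+1) - B (y i.*2.+1) (y i.*2)).
Proof.
move=> By; have [Bt ct] := cocycle_comm_tail d y.
by rewrite /relator_b cM Bt addr0 (cM (_ ^+ _)%g) bilin_commr addr0 ct cocycle_comm cocycle_expg.
Qed.
End BilinearCocycle.

(** The crossed homomorphisms on the whole group whose reduction chi takes given
    values on the generators. *)
Definition prescribed_cocycles (p d : nat) (G : groupType) (m : G -> 'Z_p)
    (x : G) (y : nat -> G) : Prop :=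
  forall (a : 'Z_p) (eta : nat -> 'Z_p),
  exists (chi : G -> 'Z_p) (e : G -> 'Z_(p ^ 2)),
  [/\ hom_on setT chi, chi x = a,
      forall k, (1 <= k <= d)%N -> chi (y k) = eta k,
      forall s t, e (s * t)%g = e s + e t + mulp (m s * chi t) &
      forall t, e t *+ p = mulp (chi t)].

Section OneRelator.
Variables (p d : nat) (G : groupType) (m : G -> 'Z_p) (x : G) (y : nat -> G).
Hypothesis p_gt1 : (1 < p)%N.
Hypothesis d_odd : odd d.
Hypothesis mM : hom_on setT m.
Hypothesis lift : prescribed_cocycles d m x y.

Let jB (chi : G -> 'Z_p) s t : 'Z_(p ^ 2) := mulp (m s * chi t).

Let jBMl chi : hom_on setT chi -> forall s t u, jB chi (s * t)%g u = jB chi s u + jB chi t u.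
Proof. by move=> chiM s t u; rewrite /jB mM // mulrDl mulpD. Qed.
Let jBMr chi : hom_on setT chi -> forall s t u, jB chi u (s * t)%g = jB chi u s + jB chi u t.
Proof. by move=> chiM s t u; rewrite /jB chiM // mulrDr mulpD. Qed.

Let tail_sum chi eta : (forall k, (1 <= k <= d)%N -> chi (y k) = eta k) ->
  \sum_(1 <= i < (d./2).+1) (jB chi (y i.*2) (y i.*2.+1) - jB chi (y i.*2.+1) (y i.*2))
  = \sum_(1 <= i < (d./2).+1) (mulp (m (y i.*2) * eta i.*2.+1) - mulp (m (y i.*2.+1) * eta i.*2)).
Proof.
move=> chi_y; apply: eq_big_nat => i /andP[i1 id].
rewrite /jB !chi_y //; lia.
Qed.

Let tail_dual j (eta : nat -> 'Z_p) : (1 <= j < (d./2).+1)%N ->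
  (forall i, i != j -> eta i.*2 = 0 /\ eta i.*2.+1 = 0) ->
  \sum_(1 <= i < (d./2).+1) (mulp (m (y i.*2) * eta i.*2.+1) - mulp (m (y i.*2.+1) * eta i.*2))
  = mulp (m (y j.*2) * eta j.*2.+1) - mulp (m (y j.*2.+1) * eta j.*2).
Proof.
move=> jd eta0; rewrite (bigD1_seq j) ?mem_index_iota ?iota_uniq //=.
by rewrite big1 ?addr0 // => i /eta0[-> ->]; rewrite !mulr0 !mulp0 subr0.
Qed.

(** The linear form first stands for the contribution of x and y_1 to the value of a
    crossed homomorphism on the relator, as a function of chi(x) and chi(y_1).
    Taking chi dual to each generator in turn separates the coefficients. *)
Let vanishing (first : 'Z_p -> 'Z_p -> 'Z_(p ^ 2)) :
  first 0 0 = 0 ->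
  (forall a (eta : nat -> 'Z_p), first a (eta 1%N) +
   \sum_(1 <= i < (d./2).+1) (mulp (m (y i.*2) * eta i.*2.+1) - mulp (m (y i.*2.+1) * eta i.*2)) = 0) ->
  [/\ first 1 0 = 0, first 0 1 = 0 & forall k, (1 < k <= d)%N -> m (y k) = 0].
Proof.
move=> first0 rel.
have tail0 (eta : nat -> 'Z_p) : (forall i, (0 < i)%N -> eta i.*2 = 0 /\ eta i.*2.+1 = 0) ->
  \sum_(1 <= i < (d./2).+1) (mulp (m (y i.*2) * eta i.*2.+1) - mulp (m (y i.*2.+1) * eta i.*2)) = 0.
  move=> eta0; rewrite big_nat big1 // => i /andP[/eta0[-> ->] _].
  by rewrite !mulr0 !mulp0 subr0.
have rel0 a (eta : nat -> 'Z_p) :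
    (forall i, (0 < i)%N -> eta i.*2 = 0 /\ eta i.*2.+1 = 0) -> first a (eta 1%N) = 0.
  by move=> eta0; have := rel a eta; rewrite tail0 // addr0.
split; first exact: (rel0 1 (fun=> 0)).
  apply: (rel0 0 (fun l => (l == 1%N)%:R)) => i i0.
  by split; rewrite (_ : (_ == _) = false) //; lia.
move=> k kd; have jd : (1 <= k./2 < (d./2).+1)%N by lia.
have km : k = (odd k + k./2.*2)%N by rewrite odd_double_half.
have relj (eta : nat -> 'Z_p) : eta 1%N = 0 ->
    (forall i, i != k./2 -> eta i.*2 = 0 /\ eta i.*2.+1 = 0) ->
    mulp (m (y k./2.*2) * eta k./2.*2.+1) - mulp (m (y k./2.*2.+1) * eta k./2.*2) = 0.
  move=> eta1 eta0; have := rel 0 eta.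
  by rewrite eta1 first0 add0r (tail_dual jd eta0).
apply: (mulp_inj p_gt1); rewrite mulp0.
case: (boolP (odd k)) km => [_|_]; rewrite /= ?add1n ?add0n => km.
  have := relj (fun l => (l == k./2.*2)%:R).
  rewrite eqxx (gtn_eqF (ltnSn _)) mulr0 mulp0 sub0r mulr1 -km => h.
  apply/eqP; rewrite -oppr_eq0; apply/eqP/h => [|i ik].
    by rewrite (_ : (_ == _) = false) //; lia.
  by split; rewrite (_ : (_ == _) = false) //; lia.
have := relj (fun l => (l == k./2.*2.+1)%:R).
rewrite eqxx (ltn_eqF (ltnSn _)) mulr0 mulp0 subr0 mulr1 -km; apply=> [|i ik].
  by rewrite (_ : (_ == _) = false) //; lia.
by split; rewrite (_ : (_ == _) = false) //; lia.
Qed.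

(** A crossed homomorphism takes on the relator the value
    p (m(x) chi(y_1) - m(y_1) chi(x) + ...), which is a nondegenerate pairing of m
    and chi. *)
Lemma relator_a_bockstein : relator_a d x y = 1%g ->
  m x = 0 /\ forall k, (1 <= k <= d)%N -> m (y k) = 0.
Proof.
move=> r1; have d_gt0 : (0 < d)%N by lia.
have [|a eta|] := @vanishing (fun a b => mulp (m x * b) - mulp (m (y 1%N) * a)).
- by rewrite !mulr0 mulp0 subr0.
- have [chi [e [chiM chix chiy eM _]]] := lift a eta.
  have := cocycle_relator_a (jBMl chiM) (jBMr chiM) eM d x y.
  by rewrite r1 (cocycle1 (jBMl chiM) eM) (tail_sum chiy) {1 2}/jB chix chiy // => <-.
rewrite !mulr0 !mulp0 !mulr1 subr0 sub0r => /eqP; rewrite oppr_eq0 => /eqP my1 mx my.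
rewrite -[RHS](mulp0 p) in my1; rewrite -[RHS](mulp0 p) in mx.
split=> [|k kd]; first exact: (mulp_inj p_gt1 mx).
have [->|k1] := eqVneq k 1%N; first exact: (mulp_inj p_gt1 my1).
by apply: my; lia.
Qed.

(** The factor y_1^p contributes p e(y_1) = p chi(y_1), so that the coefficient of
    chi(y_1) is p (1 - m(x)). *)
Lemma relator_b_bockstein : relator_b p d x y = 1%g ->
  m x = 1 /\ forall k, (1 <= k <= d)%N -> m (y k) = 0.
Proof.
move=> r1; have d_gt0 : (0 < d)%N by lia.
(* With chi dual to x the value on y_1^p is 0, as chi(y_1) = 0; this must come first,
   because the value on y_1^p is p e(y_1) only when m(y_1) chi(y_1) = 0. *)
have my10 : m (y 1%N) = 0.
  have [chi [e [chiM chix chiy eM ep]]] := lift 1 (fun=> 0).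
  have := cocycle_relator_b (jBMl chiM) (jBMr chiM) eM p d x (y := y).
  rewrite r1 (cocycle1 (jBMl chiM) eM) (tail_sum chiy) {1 2 3}/jB chix chiy // ep.
  rewrite chiy // !mulr0 mulr1 !mulp0 subr0 add0r big1 => [/(_ erefl)|i _]; last by rewrite !mulr0 mulp0 subr0.
  by rewrite addr0 -[X in X = _](mulp0 p) => /esym/(mulp_inj p_gt1).
have [|a eta|] := @vanishing (fun a b => mulp b + (mulp (m (y 1%N) * a) - mulp (m x * b))).
- by rewrite !mulr0 mulp0 subr0 addr0.
- have [chi [e [chiM chix chiy eM ep]]] := lift a eta.
  have := cocycle_relator_b (jBMl chiM) (jBMr chiM) eM p d x (y := y).
  rewrite r1 (cocycle1 (jBMl chiM) eM) (tail_sum chiy) {1 2 3}/jB chix chiy // ep.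
  by rewrite chiy // my10 !mul0r mulp0 => /(_ erefl) <-.
rewrite my10 !mul0r !mulp0 !mulr1 !sub0r => _ /eqP; rewrite subr_eq0 => /eqP/(mulp_inj p_gt1) <- my.
split=> // k kd; have [->//|k1] := eqVneq k 1%N.
by apply: my; lia.
Qed.
End OneRelator.

Section Duals.
Variables (p d : nat) (G : topGroupType) (x : G) (y : nat -> G).
Hypothesis p_gt1 : (1 < p)%N.

Lemma kummer_prescribed_cocycles (m : G -> 'Z_p) :
  kummer_lifting m -> axis_lifts p d x y -> prescribed_cocycles d m x y.
Proof.
move=> km lift a eta; have [rho [rhoM rho_open rhox rhoy]] := lift a eta.
pose chi s := heis_a1 (rho s).
have chiM : hom_on setT chi by move=> s t _ _; rewrite /chi rhoM heis_a1M.
have [||e eP] := km setT chi _ chiM.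
- by split.
- have -> : [set s | [set: G] s /\ chi s = 0] = rho @^-1` [set g | heis_a1 g = 0].
    by apply/seteqP; split=> [s []|s].
  exact: rho_open.
exists chi, e; split=> //.
- by rewrite /chi rhox.
- by move=> k kd; rewrite /chi rhoy.
- by move=> s t; have [_ ->] := eP t I.
by move=> t; have [] := eP t I.
Qed.
End Duals.

(** * Homomorphisms on a normal subgroup *)

Section NormalHom.
Variables (G : groupType) (V : zmodType) (N : set G) (e : G -> V).
Hypothesis N_normal : is_normal N.
Hypothesis eM : hom_on N e.

Let N1 : N 1%g. Proof. by case: N_normal => [[]]. Qed.
Let NM s t : N s -> N t -> N (s * t)%g. Proof. by case: N_normal => [[_ h _]] _; exact: h. Qed.
Let NV s : N s -> N (s^-1)%g. Proof. by case: N_normal => [[_ _ h]] _; exact: h. Qed.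
Let NJ s g : N s -> N (s ^ g)%g. Proof. by case: N_normal => _; apply. Qed.

Lemma hom_on1 : e 1%g = 0.
Proof. by apply: (addrI (e 1%g)); rewrite -eM // mulg1 addr0. Qed.

Lemma hom_onV t : N t -> e (t^-1)%g = - e t.
Proof. by move=> Nt; apply: (addrI (e t)); rewrite -eM ?mulgV ?subrr ?hom_on1 //; exact: NV. Qed.

Lemma hom_onJ t h : N t -> N h -> e (t ^ h)%g = e t.
Proof.
move=> Nt Nh; rewrite /conjg eM ?eM ?hom_onV //; last exact: NM; last exact: NV.
by rewrite addrCA addNr addr0.
Qed.

Lemma hom_onJ_coset t g g' : N t -> N (g^-1 * g')%g -> e (t ^ g')%g = e (t ^ g)%g.
Proof. by move=> Nt Ng; rewrite -[g'](mulKVg g) conjgM hom_onJ //; exact: NJ. Qed.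

(** These elements can be dropped from a relation at any place: they are killed by
    e together with all their conjugates. *)
Definition conj_killed (t : G) := N t /\ forall g, e (t ^ g)%g = 0.

Lemma conj_killed1 : conj_killed 1%g.
Proof. by split=> // g; rewrite conj1g hom_on1. Qed.

Lemma conj_killedM s t : conj_killed s -> conj_killed t -> conj_killed (s * t)%g.
Proof.
move=> [Ns es] [Nt et]; split=> [|g]; first exact: NM.
by rewrite conjMg eM ?es ?et ?addr0 //; exact: NJ.
Qed.

Lemma conj_killedV s : conj_killed s -> conj_killed (s^-1)%g.
Proof.
move=> [Ns es]; split=> [|g]; first exact: NV.
by rewrite conjVg hom_onV ?es ?oppr0 //; exact: NJ.
Qed.

Lemma conj_killed_comm s t : N s -> N t -> conj_killed [~ s, t]%g.
Proof.
move=> Ns Nt; split=> [|g].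
  by rewrite commgEl; apply: NM; [exact: NV | exact: NJ].
rewrite conjRg commgEl eM; [|exact/NV/NJ|exact/NJ/NJ].
by rewrite hom_onV ?(@hom_onJ (s ^ g)%g) ?addNr //; exact: NJ.
Qed.

Lemma conj_killed_prod_comm (a b : nat) (y : nat -> G) :
  (forall k, (a.*2 <= k < b.*2)%N -> N (y k)) ->
  conj_killed (\prod_(a <= i < b) [~ y i.*2, y i.*2.+1])%g.
Proof.
move=> Ny; rewrite big_nat; apply: (big_ind conj_killed).
- exact: conj_killed1.
- exact: conj_killedM.
by move=> i /andP[ai ib]; apply: conj_killed_comm; apply: Ny; lia.
Qed.

Lemma hom_on_commEl s t g : N s ->
  e ([~ s, t] ^ g)%g = e (s ^ (t * g))%g - e (s ^ g)%g.
Proof.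
move=> Ns; have -> : ([~ s, t] ^ g = (s ^ g)^-1 * s ^ (t * g))%g.
  by rewrite conjgM -conjVg -conjMg commgEl.
rewrite eM; [|exact/NV/NJ|exact: NJ].
by rewrite hom_onV 1?addrC //; exact: NJ.
Qed.

Lemma hom_on_commEr s t g : N t ->
  e ([~ s, t] ^ g)%g = e (t ^ g)%g - e (t ^ (s * g))%g.
Proof.
move=> Nt; rewrite -invgR conjVg hom_onV ?hom_on_commEl ?opprB //.
by apply: NJ; rewrite commgEl; apply: NM; [exact: NV|exact: NJ].
Qed.

Section SurfaceRelators.
Variables (p : nat) (x y1 y2 y3 z1 T1 T2 : G).
Hypothesis Ncomm : forall s t, N [~ s, t]%g.
Hypothesis Nx : N x.
Hypothesis Ny3 : N y3.
Hypothesis Ny2p : N (y2 ^+ p)%g.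
Hypothesis Nyz : N (z1^-1 * y2)%g.
Hypothesis T1_0 : conj_killed T1.
Hypothesis T2_0 : conj_killed T2.
Hypothesis r1 : ([~ x, y1] * ([~ y2, y3] * T1) = 1)%g.
Hypothesis r2 : ([~ x, z1] * T2 = 1)%g.

(** The second relator, conjugated by g. *)
Lemma hom_conj_z1 g : e (x ^ (z1 * g))%g = e (x ^ g)%g.
Proof.
have : e (([~ x, z1] * T2) ^ g)%g = 0 by rewrite r2 conj1g hom_on1.
rewrite conjMg eM; [|exact/NJ/Ncomm | exact/NJ/(proj1 T2_0)].
by rewrite (proj2 T2_0) addr0 hom_on_commEl // => /eqP; rewrite subr_eq0 => /eqP.
Qed.

(** As y2 and z1 have the same image modulo N, they conjugate x in the same way. *)
Lemma hom_conj_y2 g : e (x ^ (y2 * g))%g = e (x ^ g)%g.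
Proof.
rewrite -[RHS]hom_conj_z1; apply: hom_onJ_coset => //.
have -> : ((z1 * g)^-1 * (y2 * g) = (z1^-1 * y2) ^ g)%g.
  by rewrite conjgE invgM !mulgA.
exact: NJ.
Qed.

(** The first relator, conjugated by g; its right side is a difference of two
    consecutive terms when g is a power of y2. *)
Lemma hom_conj_y1 g : e (x ^ (y1 * g))%g - e (x ^ g)%g =
  e (y3 ^ (y2 * g))%g - e (y3 ^ g)%g.
Proof.
have : e ([~ x, y1] ^ g * ([~ y2, y3] ^ g * T1 ^ g))%g = 0.
  by rewrite -!conjMg r1 conj1g hom_on1.
have [NT1 eT1] := T1_0.
rewrite eM; [|exact/NJ/Ncomm|by apply: NM; apply: NJ].
rewrite [e (_ * T1 ^ g)%g]eM; [|exact/NJ/Ncomm|exact: NJ].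
rewrite eT1 addr0 hom_on_commEl // hom_on_commEr // => /eqP.
by rewrite addr_eq0 opprB => /eqP.
Qed.

(** Add the relations for g = 1, y2, ..., y2^(p-1).  Conjugation of x by powers of y2
    has no effect, so the p left sides are all equal; the right sides telescope to
    e(y3^(y2^p)) - e(y3), which is 0 because y2^p lies in N. *)
Lemma hom_conj_torsion : (e (x ^ y1)%g - e x) *+ p = 0.
Proof.
pose f i := e (y3 ^ (y2 ^+ i))%g.
have step i : f i.+1 - f i = e (x ^ y1)%g - e x.
  have xi g : e (x ^ (y2 ^+ i * g))%g = e (x ^ g)%g.
    elim: i g => [|i IH] g; first by rewrite expg0 mul1g.
    by rewrite expgS -mulgA hom_conj_y2 IH.
  rewrite /f expgS -hom_conj_y1 -[X in _ - e (x ^ X)%g](mulg1 (y2 ^+ i)%g) xi conjg1.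
  congr (_ - _); rewrite -[RHS]xi; apply: hom_onJ_coset => //.
  have -> : ((y2 ^+ i * y1)^-1 * (y1 * y2 ^+ i) = [~ y1, y2 ^+ i])%g.
    by rewrite invgM /commg /conjg !mulgA.
  exact: Ncomm.
have : \sum_(0 <= i < p) (f i.+1 - f i) = 0.
  rewrite telescope_sumr // /f expg0 conjg1 hom_onJ ?subrr //.
by rewrite (eq_bigr (fun=> e (x ^ y1)%g - e x)) // sumr_const_nat subn0.
Qed.
End SurfaceRelators.

Section PowerRelators.
Variables (p : nat) (x y z T1 T2 : G).
Let w := (y * z^-1)%g.
Hypothesis p_gt0 : (0 < p)%N.
Hypothesis Nw : N w.
Hypothesis Nyp : N (y ^+ p)%g.
Hypothesis Nzp : N (z ^+ p)%g.
Hypothesis T1_0 : conj_killed T1.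
Hypothesis T2_0 : conj_killed T2.
Hypothesis r1 : (y ^+ p * [~ y, x] * T1 = 1)%g.
Hypothesis r2 : (z ^+ p * [~ z, x] * T2 = 1)%g.

(** The identity (w z)^n = w w^(z^-1) ... w^(z^(1-n)) z^n, under e. *)
Lemma hom_conj_power n g : N (y ^+ n * z ^- n)%g /\
  e ((y ^+ n * z ^- n) ^ g)%g = \sum_(i < n) e (w ^ (z ^- i * g))%g.
Proof.
elim: n => [|n [Nn IH]].
  by rewrite !expg0 invg1 mulg1 conj1g hom_on1 big_ord0.
have -> : (y ^+ n.+1 * z ^- n.+1 = (y ^+ n * z ^- n) * w ^ (z ^- n))%g.
  rewrite /conjg /w invgK expgSr [(z ^+ n.+1)%g]expgSr invgM !mulgA.
  by rewrite mulgVK.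
split; first by apply: NM => //; exact: NJ.
rewrite conjMg eM; [|exact: NJ|exact/NJ/NJ].
by rewrite IH big_ord_recr /= -conjgM.
Qed.

(** The sum runs over a full period of conjugation by z, as z^p lies in N. *)
Lemma hom_conj_shift :
  \sum_(i < p) e (w ^ (z ^- i * z))%g = \sum_(i < p) e (w ^ (z ^- i * 1))%g.
Proof.
case: p p_gt0 Nzp => // q _ Nzq.
rewrite big_ord_recl [RHS]big_ord_recr /= [LHS]addrC expg0 invg1 mul1g mulg1.
congr (_ + _).
  apply: eq_bigr => i _; rewrite mulg1 /bump /= add1n expgS invgM.
  by rewrite mulgVK.
apply: esym; apply: hom_onJ_coset => //.
have -> : (z^-1 * z ^- q = (z ^+ q.+1)^-1)%g by rewrite expgSr invgM.
exact: NV.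
Qed.

(** By the relators, y^x = y^(1-p) and z^x = z^(1-p) up to elements killed by e, so
    that w^x = y^x (z^x)^-1 is y^-p w z^p up to such elements; y^p = (w z)^p is
    expanded by the preceding lemmas. *)
Lemma hom_conj_x g : (g = 1 \/ g = z)%g ->
  e (w ^ (x * g))%g = e (w ^ g)%g - \sum_(i < p) e (w ^ (z ^- i * 1))%g.
Proof.
move=> gP.
have zpg : (z ^+ p ^ g = z ^+ p)%g.
  by case: gP => ->; rewrite ?conjg1 // conjXg /conjg mulKg.
have yx : (y ^ x = y * (y ^- p * T1^-1))%g.
  have -> : (y ^- p * T1^-1 = [~ y, x])%g.
    by apply: (mulgI (y ^+ p)%g); rewrite mulVKg; apply: (mulIg T1); rewrite mulVg r1.
  by rewrite commgEl mulVKg.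
have zx : (z ^ x = z * (z ^- p * T2^-1))%g.
  have -> : (z ^- p * T2^-1 = [~ z, x])%g.
    by apply: (mulgI (z ^+ p)%g); rewrite mulVKg; apply: (mulIg T2); rewrite mulVg r2.
  by rewrite commgEl mulVKg.
pose U := (T1^-1 * T2)%g.
have U0 : conj_killed U by apply: conj_killedM => //; exact: conj_killedV.
have wx : (w ^ x = (y ^+ p)^-1 * (U ^ y^-1 * (w * z ^+ p)))%g.
  have yp : (y * y ^- p = y ^- p * y)%g by apply: commuteV; apply: commuteX; exact: commute_refl.
  have zp : (z ^+ p * z^-1 = z^-1 * z ^+ p)%g.
    by apply: commute_sym; apply/commute_sym/commuteV/commute_sym/commuteX/commute_refl.
  have -> : (w ^ x = y ^ x * (z ^ x)^-1)%g by rewrite /w conjMg conjVg.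
  rewrite yx zx !invgM !invgK /conjg invgK /w /U !mulgA yp.
  by rewrite mulgVK -!mulgA zp.
have Nwx : N (w * z ^+ p)%g by exact: NM.
rewrite conjgM wx conjMg eM; [|exact/NJ/NV|apply: NJ; apply: NM => //; exact/NJ/(proj1 U0)].
rewrite conjMg [e (_ ^ g * (w * _) ^ g)%g]eM; [|exact/NJ/NJ/(proj1 U0)|exact: NJ].
rewrite -conjgM (proj2 U0) add0r conjMg [e (w ^ g * _)%g]eM; [|exact: NJ|exact: NJ].
rewrite zpg conjVg hom_onV; last exact: NJ.
have -> : (y ^+ p = (y ^+ p * z ^- p) * z ^+ p)%g by rewrite mulgVK.
have [Nyz ->] : N (y ^+ p * z ^- p)%g /\ e ((y ^+ p * z ^- p * z ^+ p) ^ g)%g =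
    \sum_(i < p) e (w ^ (z ^- i * 1))%g + e (z ^+ p)%g.
  have [Nyz eyz] := hom_conj_power p g; split=> //.
  rewrite conjMg eM; [|exact: NJ|exact: NJ]; rewrite zpg eyz; congr (_ + _).
  by case: gP => -> //; exact: hom_conj_shift.
by rewrite opprD addrACA addNr addr0 addrC.
Qed.

(** The sum subtracted in the preceding lemma is the same for g = 1 and g = z. *)
Lemma hom_conj_rigid : e (w ^ (x * z))%g - e (w ^ z)%g = e (w ^ x)%g - e w.
Proof.
rewrite hom_conj_x; last by right.
rewrite -[(w ^ x)%g]conjg1 -conjgM hom_conj_x; last by left.
by rewrite conjg1 addrAC subrr add0r [RHS]addrAC subrr add0r.
Qed.
End PowerRelators.
End NormalHom.

(** * Failure of the Kummer lifting property *)

Lemma comm_tail_split (G : groupType) d (y : nat -> G) : (2 < d)%N ->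
  comm_tail d y = ([~ y 2%N, y 3%N] *
    \prod_(2 <= i < (d./2).+1) [~ y i.*2, y i.*2.+1])%g.
Proof. by move=> d2; rewrite /comm_tail big_ltn //; lia. Qed.

(** The subgroups on which lifts are tested.  On heisH the coordinates b1 and a2 of
    rho vanish, which makes the central coordinate c additive; it is the kernel of a
    homomorphism to (Z/p)^2.  On heisN, moreover, the action on Z/p^2 is trivial, so
    that crossed homomorphisms are homomorphisms. *)
Section Setup.
Variables (p : nat) (G : topGroupType) (m : G -> 'Z_p) (rho : G -> heis p).
Hypothesis p_gt1 : (1 < p)%N.
Hypothesis mM : hom_on setT m.
Hypothesis km : kummer_lifting m.
Hypothesis rhoM : {morph rho : s t / (s * t)%g}.
Hypothesis rho_open : forall C, open (rho @^-1` C).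

Definition heisH : set G := [set s | heis_b1 (rho s) = 0 /\ heis_a2 (rho s) = 0].
Definition heisN : set G := [set s | heisH s /\ m s = 0].

Let m1 : m 1%g = 0.
Proof. by apply: (addrI (m 1%g)); rewrite -mM // mulg1 addr0. Qed.
Lemma bocksteinV s : m (s^-1)%g = - m s.
Proof. by apply: (addrI (m s)); rewrite -mM // mulgV subrr. Qed.
Lemma bockstein_conj s g : m (s ^ g)%g = m s.
Proof. by rewrite /conjg !mM // bocksteinV addrCA addNr addr0. Qed.

Let b1V (g : heis p) : heis_b1 (g^-1)%g = - heis_b1 g.
Proof. by case: g => [[[[a1 b1] a2] b2] c]. Qed.
Let a2V (g : heis p) : heis_a2 (g^-1)%g = - heis_a2 g.
Proof. by case: g => [[[[a1 b1] a2] b2] c]. Qed.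

Lemma heisH_normal : is_normal heisH.
Proof.
have rho1 := hom_morph1 rhoM; have rhoV := hom_morphV rhoM.
split=> [|s g [sb sa]]; last first.
  by rewrite /heisH /= /conjg !rhoM rhoV !heis_b1M !heis_a2M b1V a2V sb sa !add0r !addNr.
split=> [|s t [sb sa] [tb ta]|s [sb sa]]; rewrite /heisH /=.
- by rewrite rho1.
- by rewrite rhoM heis_b1M heis_a2M sb sa tb ta !addr0.
by rewrite rhoV b1V a2V sb sa !oppr0.
Qed.

Lemma heisN_normal : is_normal heisN.
Proof.
have [[H1 HM HV] HJ] := heisH_normal.
split=> [|s g [Hs ms]]; last by split; [exact: HJ | rewrite bockstein_conj].
split=> [|s t [Hs ms] [Ht mt]|s [Hs ms]]; split; rewrite ?m1 ?mM ?bocksteinV ?ms ?mt ?addr0 ?oppr0 //.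
- exact: HM.
exact: HV.
Qed.

Lemma heisH_comm s t : heisH [~ s, t]%g.
Proof.
have rhoV := hom_morphV rhoM.
rewrite /heisH /= /commg /conjg !rhoM !rhoV !heis_b1M !heis_a2M !b1V !a2V.
by split; ring.
Qed.

Lemma heisN_comm s t : heisN [~ s, t]%g.
Proof.
split; first exact: heisH_comm.
by rewrite /commg mM // bockstein_conj bocksteinV addNr.
Qed.

Lemma heisN_expp s : heisN (s ^+ p)%g.
Proof.
have pm (a : 'Z_p) : a *+ p = 0 by rewrite -mulr_natr pchar_Zp ?mulr0.
have mX k : m (s ^+ k)%g = m s *+ k.
  by elim: k => [|k IH]; rewrite ?expg0 ?m1 // expgS mM // IH mulrS.
have b1X k : heis_b1 (rho (s ^+ k)%g) = heis_b1 (rho s) *+ k.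
  by elim: k => [|k IH]; rewrite ?expg0 ?(hom_morph1 rhoM) // expgS rhoM heis_b1M IH mulrS.
have a2X k : heis_a2 (rho (s ^+ k)%g) = heis_a2 (rho s) *+ k.
  by elim: k => [|k IH]; rewrite ?expg0 ?(hom_morph1 rhoM) // expgS rhoM heis_a2M IH mulrS.
by split; [split; rewrite ?b1X ?a2X pm | rewrite mX pm].
Qed.

(** The last formula compares e(t s) and e(s t^s), which are equal. *)
Lemma heis_kummer : exists e : G -> 'Z_(p ^ 2),
  [/\ hom_on heisN e, forall t, heisH t -> e t *+ p = mulp (heis_c (rho t))
    & forall s t, heisH s -> heisN t ->
        e (t ^ s)%g = e t - mulp (m s * heis_c (rho t))].
Proof.
have [[H1 HM HV] HJ] := heisH_normal.
have [|||e eP] := @km heisH (fun s => heis_c (rho s)).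
- by split.
- by move=> s t [sb sa] [tb ta]; rewrite rhoM heis_cM.
- rewrite (_ : mkset _ = rho @^-1` [set g | (heis_b1 g = 0 /\ heis_a2 g = 0) /\ heis_c g = 0]) //.
exists e; split.
- move=> s t [Hs ms] [Ht mt]; have [_ ->//] := eP t Ht.
  by rewrite ms mul0r mulp0 addr0.
- by move=> t Ht; have [] := eP t Ht.
move=> s t Hs [Ht mt]; have Hts : heisH (t ^ s)%g by exact: HJ.
have [_ /(_ s Hs) h1] := eP _ Hts; have [_ /(_ t Ht) h2] := eP _ Hs.
move: h1; rewrite -conjgC h2 mt mul0r mulp0 addr0.
have -> : heis_c (rho (t ^ s)%g) = heis_c (rho t).
  have cM s' t' : heisH s' -> heisH t' -> heis_c (rho (s' * t')%g) = heis_c (rho s') + heis_c (rho t').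
    by move=> [_ sa] [tb _]; rewrite rhoM heis_cM.
  have := cM t s Ht Hs; rewrite conjgC cM // [RHS]addrC => /addrI.
  exact.
by rewrite [LHS]addrC -[RHS]addrA => /addrI ->; rewrite addrK.
Qed.
End Setup.

Lemma heis_conjE p (a1 b1 a2 b2 c a1' b1' a2' b2' c' : 'Z_p) :
  (Heis a1 b1 a2 b2 c ^ Heis a1' b1' a2' b2' c')%g =
  Heis a1 b1 a2 b2 (c + (a1 * b1' - a1' * b1 + (a2 * b2' - a2' * b2))).
Proof. by rewrite conjg_mulR heis_commE heis_mulE; congr Heis; ring. Qed.

Section NotKummerian.
Variables (p d1 d2 : nat) (G : topGroupType) (x : G) (y z : nat -> G).
Hypothesis p_pr : prime p.
Hypothesis d1_odd : odd d1.
Hypothesis d2_odd : odd d2.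

Let p_gt1 : (1 < p)%N. Proof. exact: prime_gt1. Qed.

(** Under rho, [x, y_1] and [y_2, y_3] are inverse to each other and nontrivial, z_1
    and y_2 have the same image, which commutes with that of x, and the remaining
    generators are trivial. *)
Theorem relators_a_not_kummerian : (2 < d1)%N ->
  relator_a d1 x y = 1%g -> relator_a d2 x z = 1%g ->
  heis_lifts d1 d2 x y z (relators_a p d1 d2) -> ~ kummerian p G.
Proof.
move=> d1_gt2 r1 r2 lift [m mM km].
have [lift_y lift_z] := heis_lifts_axis (@relators_a_axis p d1 d2) lift.
have [mx my] := relator_a_bockstein p_gt1 d1_odd mM
  (kummer_prescribed_cocycles km lift_y) r1.
have [_ mz] := relator_a_bockstein p_gt1 d2_odd mM
  (kummer_prescribed_cocycles km lift_z) r2.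
pose hx : heis p := Heis 1 0 0 0 0.
pose hy k : heis p := if k == 1%N then Heis 0 1 0 0 0 else
  if k == 2%N then Heis 0 0 1 0 0 else if k == 3%N then Heis 0 0 0 (- 1) 0 else 1%g.
pose hz k : heis p := if k == 1%N then Heis 0 0 1 0 0 else 1%g.
have hy1 k : (3 < k)%N -> hy k = 1%g.
  by move=> k3; rewrite /hy; do 3![case: eqP => [|_]; first by lia].
have hz1 k : (1 < k)%N -> hz k = 1%g.
  by move=> k1; rewrite /hz; case: eqP => [|_] //; lia.
have [|rho [rhoM rho_open rhox rhoy rhoz]] := lift hx hy hz.
  split; rewrite /relator_a.
    rewrite comm_tail_split // big_nat big1 => [|i /andP[i2 _]]; last first.
      by rewrite hy1 ?comm1g //; lia.
    rewrite mulg1 /hx /hy /= !heis_commE heis_mulE heis_oneE.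
    by congr Heis; ring.
  rewrite comm_tail_trivial => [|i i0]; last first.
    by rewrite hz1 ?comm1g //; lia.
  rewrite mulg1 /hx /hz /= heis_commE heis_oneE.
  by congr Heis; ring.
have [e [eN ep _]] := heis_kummer km rhoM rho_open.
have Nnorm := heisN_normal mM rhoM.
have Ncomm := heisN_comm mM rhoM.
have rhoV := hom_morphV rhoM.
have Nx : heisN m rho x by split; rewrite // /heisH /= rhox.
have Ny k : (2 < k <= d1)%N -> heisN m rho (y k).
  move=> kd; split; last by apply: my; lia.
  rewrite /heisH /= rhoy; last by lia.
  rewrite /hy; case: eqP => [|_]; first by lia.
  by case: eqP => [|_]; [lia | case: eqP].
have Nz k : (1 < k <= d2)%N -> heisN m rho (z k).
  move=> kd; split; last by apply: mz; lia.
  rewrite /heisH /= rhoz; last by lia.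
  by rewrite hz1 //; lia.
have Nyz : heisN m rho ((z 1%N)^-1 * y 2%N)%g.
  split; last by rewrite mM // bocksteinV // mz ?my ?oppr0 ?addr0 //; lia.
  rewrite /heisH /= rhoM rhoV rhoz ?rhoy; try lia.
  by rewrite heis_b1M heis_a2M /=; split; rewrite /heis_b1 /heis_a2 /= ?oppr0 ?addr0 ?addNr.
have T1_0 : conj_killed (heisN m rho) e
    (\prod_(2 <= i < (d1./2).+1) [~ y i.*2, y i.*2.+1])%g.
  by apply: conj_killed_prod_comm => // k kd; apply: Ny; lia.
have T2_0 : conj_killed (heisN m rho) e (comm_tail d2 z).
  by apply: conj_killed_prod_comm => // k kd; apply: Nz; lia.
rewrite /relator_a comm_tail_split // in r1.
have Ny3 : heisN m rho (y 3%N) by apply: Ny.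
have := hom_conj_torsion Nnorm eN Ncomm Nx Ny3 (heisN_expp p_gt1 mM rhoM (y 2%N)) Nyz T1_0 T2_0 r1 r2.
have [[_ _ _] NJ] := Nnorm.
rewrite mulrnBl ep ?ep; [|exact: (proj1 Nx)|exact: (proj1 (NJ _ _ Nx))].
move/eqP; rewrite subr_eq0 => /eqP/(mulp_inj p_gt1).
rewrite (hom_morphJ rhoM) rhox rhoy; last by lia.
rewrite (_ : hy 1%N = Heis 0 1 0 0 0) // /hx heis_conjE /heis_c /= => /eqP.
by rewrite !(mulr0, mul0r, mulr1, subr0, addr0, add0r) oner_eq0.
Qed.

(** Under rho, x is trivial, and y_1 z_1^-1 and z_1 do not commute.  The relators are
    mapped to p-th powers, which are trivial as p is odd. *)
Theorem relators_b_not_kummerian : odd p ->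
  relator_b p d1 x y = 1%g -> relator_b p d2 x z = 1%g ->
  heis_lifts d1 d2 x y z (relators_b p d1 d2) -> ~ kummerian p G.
Proof.
move=> p_odd r1 r2 lift [m mM km].
have [lift_y lift_z] := heis_lifts_axis (fun a b c => @relators_b_axis p d1 d2 a b c p_gt1) lift.
have [mx my] := relator_b_bockstein p_gt1 d1_odd mM
  (kummer_prescribed_cocycles km lift_y) r1.
have [_ mz] := relator_b_bockstein p_gt1 d2_odd mM
  (kummer_prescribed_cocycles km lift_z) r2.
pose hy k : heis p := if k == 1%N then Heis 1 1 0 0 1 else 1%g.
pose hz k : heis p := if k == 1%N then Heis 0 1 0 0 0 else 1%g.
have hy1 k : (1 < k)%N -> hy k = 1%g.
  by move=> k1; rewrite /hy; case: eqP => [|_] //; lia.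
have hz1 k : (1 < k)%N -> hz k = 1%g.
  by move=> k1; rewrite /hz; case: eqP => [|_] //; lia.
have [|rho [rhoM rho_open rhox rhoy rhoz]] := lift 1%g hy hz.
  split; rewrite /relator_b heis_expp // commg1 mulg1 mul1g comm_tail_trivial // => i i0.
    by rewrite hy1 ?comm1g //; lia.
  by rewrite hz1 ?comm1g //; lia.
have [e [eN ep eJ]] := heis_kummer km rhoM rho_open.
have Nnorm := heisN_normal mM rhoM.
have rhoV := hom_morphV rhoM.
have [[_ _ _] HJ] := heisH_normal rhoM.
have Ny k : (1 < k <= d1)%N -> heisN m rho (y k).
  move=> kd; split; last by apply: my; lia.
  by rewrite /heisH /= rhoy ?hy1 //; lia.
have Nz k : (1 < k <= d2)%N -> heisN m rho (z k).
  move=> kd; split; last by apply: mz; lia.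
  by rewrite /heisH /= rhoz ?hz1 //; lia.
have rhow : rho (y 1%N * (z 1%N)^-1)%g = Heis 1 0 0 0 0.
  rewrite rhoM rhoV rhoy ?rhoz; try lia.
  by rewrite /hy /hz /= heis_invE heis_mulE; congr Heis; ring.
set w := (y 1%N * (z 1%N)^-1)%g in rhow.
have Hx : heisH rho x by rewrite /heisH /= rhox.
have Nw : heisN m rho w.
  split; first by rewrite /heisH /= rhow.
  by rewrite mM // bocksteinV // my ?mz ?oppr0 ?addr0 //; lia.
have T1_0 : conj_killed (heisN m rho) e (comm_tail d1 y).
  by apply: conj_killed_prod_comm => // k kd; apply: Ny; lia.
have T2_0 : conj_killed (heisN m rho) e (comm_tail d2 z).
  by apply: conj_killed_prod_comm => // k kd; apply: Nz; lia.
have expp := heisN_expp p_gt1 mM rhoM.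
have [_ NJ] := Nnorm.
have Nwz := NJ _ (z 1%N) Nw.
have := hom_conj_rigid Nnorm eN (prime_gt0 p_pr) Nw (expp _) (expp _) T1_0 T2_0 r1 r2.
rewrite -/w conjgM conjJg (eJ _ _ (HJ _ (z 1%N) Hx) Nwz) (eJ _ _ Hx Nw).
rewrite (bockstein_conj mM) mx !mul1r addrAC subrr add0r addrAC subrr add0r.
move/oppr_inj/(mulp_inj p_gt1).
rewrite (hom_morphJ rhoM) rhow rhoz; last by lia.
rewrite (_ : hz 1%N = Heis 0 1 0 0 0) // heis_conjE /heis_c /= => /eqP.
by rewrite !(mulr0, mul0r, mulr1, subr0, addr0, add0r) oner_eq0.
Qed.
End NotKummerian.

(** * Presented groups: relators, lifts and obstructions *)

(** Take chi1 dual to x and chi2 dual to y_1: only the commutator of x and y_1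
    contributes to the value of psi on the relator, and it contributes 1 or -1. *)
Lemma relators_cup_nontrivial (L : fieldType) (p d : nat) (G : topGroupType)
  (x : G) (y : nat -> G) :
  p \in [pchar L] -> odd d ->
  relator_a d x y = 1%g \/ relator_b p d x y = 1%g ->
  axis_lifts p d x y ->
  ~ cup_products_vanish p L G.
Proof.
move=> charL d_odd r1 lift cup.
have p_gt1 := prime_gt1 (pcharf_prime charL).
have dual a (b : nat -> 'Z_p) : exists chi : G -> 'Z_p,
    [/\ hom_on setT chi, open [set s | chi s = 0], chi x = a
      & forall k, (1 <= k <= d)%N -> chi (y k) = b k].
  have [rho [rhoM rho_open rhox rhoy]] := lift a b.
  exists (fun s => heis_a1 (rho s)); split.
  - by move=> s t _ _; rewrite rhoM heis_a1M.
  - exact: (rho_open [set g | heis_a1 g = 0]).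
  - by rewrite rhox.
  by move=> k kd; rewrite rhoy.
have [chi1 [chi1M chi1_open chi1x chi1y]] := dual 1 (fun=> 0).
have [chi2 [chi2M chi2_open chi2x chi2y]] := dual 0 (fun k => (k == 1%N)%:R).
have [psi psiM] := cup _ _ chi1M chi2M chi1_open chi2_open.
pose B (s t : G) := fp_embed L (chi1 s) * fp_embed L (chi2 t).
have BMl s t u : B (s * t)%g u = B s u + B t u.
  by rewrite /B chi1M // fp_embedD // mulrDl.
have BMr s t u : B u (s * t)%g = B u s + B u t.
  by rewrite /B chi2M // fp_embedD // mulrDr.
have psi1 := cocycle1 BMl psiM.
have f0 : fp_embed L (0 : 'Z_p) = 0 by [].
have Bx k : (1 <= k <= d)%N -> forall s, B (y k) s = 0.
  by move=> kd s; rewrite /B chi1y // f0 mul0r.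
have Bxy : B x (y 1%N) = 1.
  rewrite /B chi1x chi2y ?eqxx; last by lia.
  by rewrite (fp_embed_nat charL 1) mulr1.
have tail : \sum_(1 <= i < (d./2).+1) (B (y i.*2) (y i.*2.+1) - B (y i.*2.+1) (y i.*2)) = 0.
  rewrite big_nat big1 // => j /andP[j1 jd]; rewrite !Bx ?subr0 //; lia.
case: r1 => r1.
  have := cocycle_relator_a BMl BMr psiM d x y.
  rewrite r1 psi1 tail Bxy Bx ?subr0 ?addr0; last by lia.
  by move/esym/eqP; rewrite oner_eq0.
have := cocycle_relator_b BMl BMr psiM p d x (y := y).
rewrite r1 psi1 tail Bxy !Bx; try lia.
rewrite sub0r addr0 -mulr_natr (pcharf0 charL) mulr0 add0r => /(_ erefl)/esym/eqP.
by rewrite oppr_eq0 oner_eq0.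
Qed.

Section RelatorMorph.
Variables (A B : groupType) (f : A -> B).
Hypothesis fM : {morph f : s t / (s * t)%g}.

Lemma morph_comm s t : f [~ s, t]%g = [~ f s, f t]%g.
Proof. by rewrite /commg fM (hom_morphJ fM) (hom_morphV fM). Qed.

Lemma morph_comm_tail d y (u : nat -> B) :
  odd d -> (forall k, (1 <= k <= d)%N -> f (y k) = u k) -> f (comm_tail d y) = comm_tail d u.
Proof.
move=> d_odd fy; rewrite /comm_tail !big_nat.
apply: (big_ind2 (fun a b => f a = b)) => [|s s' t t' <- <-|j jd].
- exact: hom_morph1.
- by rewrite fM.
by rewrite morph_comm !fy //; lia.
Qed.

Lemma morph_relator_a d x y u v : odd d -> f x = u ->
  (forall k, (1 <= k <= d)%N -> f (y k) = v k) -> f (relator_a d x y) = relator_a d u v.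
Proof.
move=> d_odd <- fy; rewrite /relator_a fM morph_comm (morph_comm_tail d_odd fy) fy //; lia.
Qed.

Lemma morph_relator_b p d x y u v : odd d -> f x = u ->
  (forall k, (1 <= k <= d)%N -> f (y k) = v k) -> f (relator_b p d x y) = relator_b p d u v.
Proof.
move=> d_odd <- fy; rewrite /relator_b fM (fM (_ ^+ _)%g) morph_comm (morph_comm_tail d_odd fy).
have fX s k : f (s ^+ k)%g = (f s ^+ k)%g.
  by elim: k => [|k IH]; rewrite ?expg0 ?(hom_morph1 fM) // !expgS fM IH.
by rewrite fX fy //; lia.
Qed.
End RelatorMorph.

(** The two kinds of relators are treated together: all that matters about rel is
    that it is preserved by homomorphisms and involves only y_1, ..., y_d. *)
Lemma presentation_heis_lifts (p d1 d2 : nat) (F G Gam : topGroupType) (x : F) (y z : nat -> F)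
  (rel : forall A : groupType, nat -> A -> (nat -> A) -> A) :
  prime p ->
  (forall (A B : groupType) (f : A -> B), {morph f : s t / (s * t)%g} ->
     forall d x y u v, odd d -> f x = u -> (forall k, (1 <= k <= d)%N -> f (y k) = v k) ->
     f (rel A d x y) = rel B d u v) ->
  odd d1 -> odd d2 ->
  pro_p_presentation p (generators (d1 := d1) (d2 := d2) x y z)
    [set rel F d1 x y; rel F d2 x z] G ->
  top_isom G Gam ->
  exists (x' : Gam) (y' z' : nat -> Gam),
    [/\ rel Gam d1 x' y' = 1%g, rel Gam d2 x' z' = 1%g &
      heis_lifts d1 d2 x' y' z' (fun hx hy hz =>
        rel (heis p) d1 hx hy = 1%g /\ rel (heis p) d2 hx hz = 1%g)].
Proof.
move=> p_pr relM d1_odd d2_odd pres [phi [phi' [[phi_c phiM] [phi'_c phi'M] phiK phi'K]]].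
have [pi [piM [piR lift]]] := presentation_lift pres.
have fM : {morph phi \o pi : s t / (s * t)%g} by move=> s t /=; rewrite piM phiM.
have f1 := hom_morph1 phiM.
exists (phi (pi x)), (fun k => phi (pi (y k))), (fun k => phi (pi (z k))); split.
- rewrite -(relM _ _ _ fM d1 x y) //= piR //; by left.
- rewrite -(relM _ _ _ fM d2 x z) //= piR //; by right.
move=> hx hy hz [r1 r2].
have [|rho [rhoM rho_open rhoE]] := lift (heis p) (heis_pgroup p_pr)
    (generators (d1 := d1) (d2 := d2) hx (fun k => hy k) (fun k => hz k)).
  move=> f fMorph fE _ [|] ->.
    rewrite -r1; apply: (relM _ _ f fMorph) => //; first exact: (fE None).
    move=> [//|k] kd; exact: (fE (Some (inl (Ordinal (kd : k < d1)%N)))).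
  rewrite -r2; apply: (relM _ _ f fMorph) => //; first exact: (fE None).
  move=> [//|k] kd; exact: (fE (Some (inr (Ordinal (kd : k < d2)%N)))).
exists (rho \o phi'); split.
- by move=> s t /=; rewrite phi'M rhoM.
- by move=> C; have /continuousP h := phi'_c; apply: (h _ (rho_open C)).
- by rewrite /= phiK (rhoE None).
- move=> [//|k] kd; rewrite /= phiK.
  exact: (rhoE (Some (inl (Ordinal (kd : k < d1)%N)))).
move=> [//|k] kd; rewrite /= phiK.
exact: (rhoE (Some (inr (Ordinal (kd : k < d2)%N)))).
Qed.

(** In case (a) one of d1 and d2 is at least 3, and the situation is symmetric in the
    y_k and the z_k. *)
Lemma presented_not_kummerian_cup_nonzero (p d1 d2 : nat) (F G Gam : topGroupType)
  (x : F) (y z : nat -> F) :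
  prime p -> odd d1 -> odd d2 ->
  ((4 <= d1 + d2)%N /\
      pro_p_presentation p (generators (d1 := d1) (d2 := d2) x y z)
        [set relator_a d1 x y; relator_a d2 x z] G)
     \/
     (odd p /\
      pro_p_presentation p (generators (d1 := d1) (d2 := d2) x y z)
        [set relator_b p d1 x y; relator_b p d2 x z] G) ->
  top_isom G Gam ->
  ~ kummerian p Gam /\
  forall L : fieldType, p \in [pchar L] ->
  ~ cup_products_vanish p L Gam.
Proof.
move=> p_pr d1_odd d2_odd pres iso; have p_gt1 := prime_gt1 p_pr.
case: pres => [[d4 pres]|[p_odd pres]].
  have [|x' [y' [z' [r1 r2 lift]]]] := presentation_heis_lifts
    (rel := @relator_a) p_pr _ d1_odd d2_odd pres iso.
    by move=> A B f fM d u v u' v'; exact: morph_relator_a.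
  split; last first.
    move=> L charL; apply: (relators_cup_nontrivial charL d1_odd (or_introl r1)).
    by have [] := heis_lifts_axis (@relators_a_axis p d1 d2) lift.
  case: (leqP d1 2) => d1_le; last exact: (relators_a_not_kummerian p_pr d1_odd d2_odd _ r1 r2 lift).
  apply: (relators_a_not_kummerian p_pr d2_odd d1_odd _ r2 r1); first by lia.
  move=> hx hy hz [h1 h2]; have [//|rho [? ? ? ? ?]] := lift hx hz hy.
  by exists rho.
have [|x' [y' [z' [r1 r2 lift]]]] := presentation_heis_lifts
    (rel := @relator_b p) p_pr _ d1_odd d2_odd pres iso.
  by move=> A B f fM d u v u' v'; exact: morph_relator_b.
split; first exact: (relators_b_not_kummerian p_pr d1_odd d2_odd _ r1 r2 lift).
move=> L charL; apply: (relators_cup_nontrivial charL d1_odd (or_intror r1)).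
by have [] := heis_lifts_axis (fun a b c => @relators_b_axis p d1 d2 a b c p_gt1) lift.
Qed.

(** Cosets of the stabilizer of z correspond to images of z, which are among the p - 1
    elements z, z^2, ..., z^(p-1); the index is a power of p, hence 1. *)
Lemma pro_p_gal_fixes_root (p : nat) (K L : fieldType) (i : {rmorphism K -> L})
  (G : topGroupType) (z : L) :
  prime p -> pro_p p G -> top_isom G (Defs.gal i) -> p.-primitive_root z ->
  forall s : Defs.gal i, s z = z.
Proof.
move=> p_pr [_ Gp] [phi [phi' [[phi_c phiM] _ phiK phi'K]]] zP.
have p_gt0 := prim_order_gt0 zP.
have phi1 := hom_morph1 phiM; have phiV := hom_morphV phiM.
have zs (s : Defs.gal i) : exists k, s z = z ^+ k.
  have [|k kE] := prim_rootP zP (x := s z); last by exists k.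
  by rewrite -gal_funX (prim_expr_order zP) rmorph1.
pose N := [set g | phi g z = z].
have NP g h : N (g^-1 * h)%g <-> phi h z = phi g z.
  rewrite /N /= phiM phiV gal_mulE; split=> [gh|->]; last exact: gal_invK.
  by rewrite -[in RHS]gh -gal_mulE mulgV gal_oneE.
have N_normal : is_normal N.
  split=> [|g h Ng].
    split=> [|g h Ng Nh|g Ng].
    - by rewrite /N /= phi1.
    - by rewrite /N /= phiM gal_mulE Nh.
    by rewrite /N /= phiV -[in LHS]Ng gal_invK.
  rewrite /N /= /conjg !phiM phiV !gal_mulE; have [k kE] := zs (phi h).
  by rewrite kE gal_funX Ng -kE gal_invK.
have N_open : open N.
  have /continuousP h := phi_c; apply: (h [set s : Defs.gal i | s z = z]).
  suff : krull_open [set s : Defs.gal i | s z = z] by [].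
  move=> s sz; exists [:: z] => t ts; rewrite /= -[RHS]sz; apply: ts.
  by rewrite inE.
have [n nE] := Gp N N_normal N_open.
have sub : lcosets_of N `<=` (fun k => [set g | phi g z = z ^+ k.+1]) @` `I_p.-1.
  move=> _ [g _ <-].
  have [k kp kE] : exists2 k, (k < p.-1)%N & phi g z = z ^+ k.+1.
    have [k kE] := zs (phi g).
    have : phi g z = z ^+ (k %% p) by rewrite (prim_expr_mod zP).
    have := ltn_pmod k p_gt0; case: (k %% p)%N => [_ gz|k' k'p gz]; last first.
      by exists k' => //; lia.
    have z1 : z = 1 by apply: (fmorph_inj (phi g)); rewrite rmorph1 -[LHS]/(phi g z) gz.
    by have := prim_order_dvd zP 1; rewrite z1 expr1n eqxx dvdn1 gtn_eqF ?prime_gt1.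
  exists k => //; apply/seteqP; split=> [h /= hz|h [u Nu <-]].
    exists (g^-1 * h)%g; last by rewrite mulKVg.
    by apply/NP; rewrite hz kE.
  by rewrite /= phiM gal_mulE Nu kE.
have pn : (p ^ n <= p.-1)%N.
  rewrite -card_le_II -(card_le_eql nE).
  exact: card_le_trans (subset_card_le sub) (card_image_le _ _).
have n0 : n = 0%N.
  case: n pn {nE} => // n; rewrite leqNgt expnS.
  by rewrite (leq_trans (n := p)) ?leq_pmulr ?expn_gt0 ?p_gt0 // prednK.
rewrite n0 expn0 in nE.
have NT : forall g, N g.
  move=> g; have /eq_cardSP[C _ C0] := nE.
  have onlyC D : lcosets_of N D -> D = C.
    move=> ND; apply: contrapT => DC.
    have /eqP C00 : lcosets_of N `\ C == set0 by rewrite -(@card_eq0 _ nat) -II0.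
    by have : (lcosets_of N `\ C) D by []; rewrite C00.
  have N1 : N 1%g by case: N_normal => [[]].
  have cosetN h : lcosets_of N [set (h * u)%g | u in N] by exists h.
  have : [set (g * u)%g | u in N] g by exists 1%g; rewrite ?mulg1.
  rewrite (onlyC _ (cosetN g)) -(onlyC _ (cosetN 1%g)) => -[u Nu <-].
  by rewrite mul1g.
by move=> s; rewrite -(phi'K s); exact: NT.
Qed.

(** * The theorem *)

Lemma Kp_alg (p : nat) (K Ks : fieldType) (i : {rmorphism K -> Ks}) :
  is_separable_closure i -> algebraic_over (Kp_inj p i).
Proof.
move=> sepK a; have [q q0 qa] := sep_closure_alg sepK (val a).
exists q => //; rewrite -(fmorph_root (val : {rmorphism Kp p i -> Ks})).
by rewrite -map_poly_comp (eq_map_poly (g := i)).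
Qed.

(** A root of 1 + X + ... + X^(p-1), which divides the separable polynomial
    X^p - 1. *)
Lemma sep_closure_prim_root (p : nat) (K Ks : fieldType) (i : {rmorphism K -> Ks}) :
  is_separable_closure i -> prime p -> p%:R != 0 :> Ks ->
  exists z : Ks, p.-primitive_root z.
Proof.
move=> [_ sep_root] p_pr p0; have p_gt1 := prime_gt1 p_pr.
pose q : {poly Ks} := \sum_(k < p) 'X^k.
have qE : 'X^p - 1 = ('X - 1) * q by rewrite subrX1.
have [||z qz] := sep_root q.
- apply: (@dvdp_separable _ ('X^p - 1)); first by rewrite qE dvdp_mull.
  by rewrite separable_Xn_sub_1.
- have : size ('X^p - 1 : {poly Ks}) = p.+1 by rewrite size_XnsubC // ltnW.
  rewrite qE -polyC1; have [->|q0] := eqVneq q 0; first by rewrite mulr0 size_poly0.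
  by rewrite mulrC size_Mmonic ?monicXsubC // size_XsubC addn2 /= => -[->].
exists z; have zp : z ^+ p = 1.
  apply/eqP; rewrite -subr_eq0; have : ('X^p - 1).[z] = 0 by rewrite qE hornerM (eqP qz) mulr0.
  by rewrite !hornerE => ->.
have [d dP /(prime_nt_dvdP _)] := prim_order_exists (ltnW p_gt1) zp.
have d1 : d != 1%N.
  apply/eqP => d1; rewrite d1 in dP; have z1 : z = 1 by rewrite -(prim_expr_order dP) expr1.
  move: qz; rewrite z1 /root horner_sum.
  under eq_bigr => k _ do rewrite hornerXn expr1n.
  by rewrite sumr_const card_ord (negPf p0).
by move=> /(_ p_pr d1) dp; rewrite dp in dP.
Qed.

Lemma sep_closure_as_root (p : nat) (K Ks : fieldType) (i : {rmorphism K -> Ks}) :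
  is_separable_closure i -> p \in [pchar Ks] -> forall c : Ks, exists b, b ^+ p - b = c.
Proof.
move=> [_ sep_root] charK c; have p_gt1 := prime_gt1 (pcharf_prime charK).
have [||b] := sep_root ('X^p - 'X - c%:P).
- rewrite separable_poly.unlock !derivE -mulr_natl.
  rewrite -polyC_natr (pcharf0 charK) mul0r sub0r subr0.
  by apply/Bezout_coprimepP; exists (0, - 1); rewrite /= mul0r add0r mulrNN mulr1 eqpxx.
- rewrite -addrA size_addl ?size_polyXn; first by rewrite ltnS ltnW.
  by rewrite -opprD size_opp size_XaddC ltnS.
by rewrite /root !hornerE subr_eq0 => /eqP <-; exists b.
Qed.

Theorem corollary1p2
  (p d1 d2 : nat) (p_prime : prime p) (d1_odd : odd d1) (d2_odd : odd d2)
  (F : topGroupType) (x : F) (y z : nat -> F) (G : topGroupType)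
  (G_pres :
     ((4 <= d1 + d2)%N /\
      pro_p_presentation p (generators (d1 := d1) (d2 := d2) x y z)
        [set relator_a d1 x y; relator_a d2 x z] G)
     \/
     (odd p /\
      pro_p_presentation p (generators (d1 := d1) (d2 := d2) x y z)
        [set relator_b p d1 x y; relator_b p d2 x z] G)) :
  (forall (K Ks : fieldType) (i : {rmorphism K -> Ks}),
     is_separable_closure i ->
     (exists zeta : K, p.-primitive_root zeta) ->
     (p = 2%N -> exists a : K, a ^+ 2 = - 1) ->
     ~ top_isom G (max_pro_p_galois_group p i))
  /\
  (forall (K Ks : fieldType) (i : {rmorphism K -> Ks}),
     is_separable_closure i ->
     ~ top_isom G (abs_galois_group i)).
Proof.
split=> [K Ks i sepK [zeta zetaP] _ iso|K Ks i sepK iso].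
  have [not_kummer _] := presented_not_kummerian_cup_nonzero p_prime d1_odd d2_odd G_pres iso.
  apply: not_kummer; apply: (gal_kummerian (z := Kp_inj p i zeta) (Kp_alg sepK) p_prime).
  - by rewrite fmorph_primitive_root.
  - by move=> s; rewrite gal_base.
  exact: (Kp_pth_root sepK p_prime zetaP).
have [not_kummer not_cup] :=
  presented_not_kummerian_cup_nonzero p_prime d1_odd d2_odd G_pres iso.
have [charK|charK] := boolP (p \in [pchar Ks]).
  apply: (not_cup Ks charK).
  exact: gal_cup_products_vanish (sep_closure_alg sepK) charK (sep_closure_as_root sepK charK).
have p0 : p%:R != 0 :> Ks by apply: contra charK => p0; rewrite inE p_prime.
have [zeta zetaP] := sep_closure_prim_root sepK p_prime p0.
have Gp : pro_p p G by case: G_pres => [[_ []]|[_ []]].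
apply: not_kummer; apply: (gal_kummerian (sep_closure_alg sepK) p_prime zetaP).
  exact: pro_p_gal_fixes_root p_prime Gp iso zetaP.
by move=> a; apply: (sep_closure_pth_root sepK) => //; exact: prime_gt0.
Qed.
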